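(* Let $r\ge1$, let $N$ be a nonzero proper ideal of $A$, and let $\delta$ be an injective selection of $\mathrm{Free}_N^r$. Then there is a bijection $$\bigsqcup_{\substack{0\le s\le r\\ U\in\mathrm{Free}_N^{s,r}}}\mathcal L_N^s\longrightarrow\overleftarrow{\mathcal L_N^r},\qquad(\Lambda,\alpha)_U\longmapsto(\Lambda,\delta_U\circ\alpha^{-1}),$$ where $(\Lambda,\alpha)_U$ denotes the element $(\Lambda,\alpha)$ of the copy of $\mathcal L_N^s$ indexed by $U\in\mathrm{Free}_N^{s,r}$.
   Context: Setting. $F$ is a global function field of prime characteristic; $\infty$ is a fixed place of $F$; $A\subset F$ is the ring of elements regular away from $\infty$; $F_\infty$ is the completion of $F$ at $\infty$ and $\mathbb C_\infty$ is the completion of an algebraic closure of $F_\infty$. A lattice is a finitely generated $A$-submodule $\Lambda\subset\mathbb C_\infty$ meeting every ball of finite radius in a finite set; its rank is its rank as a projective $A$-module. For $s\ge0$, $\mathcal L_N^s$ is the set of pairs $(\Lambda,\alpha)$ with $\Lambda$ a lattice of rank $s$ and $\alpha:(N^{-1}/A)^s\to N^{-1}\Lambda/\Lambda$ an $A/N$-module isomorphism (for $s=0$ it is a single point). $\overleftarrow{\mathcal L_N^r}$ is the set of pairs $(\Lambda,\iota)$ with $\Lambda$ a lattice of rank $\le r$ and $\iota:N^{-1}\Lambda/\Lambda\to(N^{-1}/A)^r$ an injective $A/N$-module homomorphism. $\mathrm{Free}_N^{s,r}$ is the set of free $A/N$-submodules of rank $s$ of $(N^{-1}/A)^r$ (note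 that $N^{-1}/A\cong A/N$ as $A/N$-modules), and $\mathrm{Free}_N^r=\bigsqcup_{s=0}^r\mathrm{Free}_N^{s,r}$. An injective selection $\delta$ of $\mathrm{Free}_N^r$ assigns to each $U\in\mathrm{Free}_N^{s,r}$ (for each $0\le s\le r$) an injective $A/N$-module homomorphism $\delta_U:(N^{-1}/A)^s\to(N^{-1}/A)^r$ with $\operatorname{Im}\delta_U=U$. *)

(* Defs.v *)
From HB Require Import structures.
From mathcomp Require Import all_boot all_order all_algebra.
From mathcomp Require Import generic_quotient ring_quotient.
From mathcomp Require Import boolp classical_sets functions cardinality reals.

Set Implicit Arguments.
Unset Strict Implicit.
Unset Printing Implicit Defensive.

Import Order.TTheory GRing.Theory Num.Theory.
Local Open Scope classical_set_scope.
Local Open Scope ring_scope.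
Local Open Scope quotient_scope.

(* A finite extension of F_p(t) for some prime p; F then has characteristic p. *)
Definition global_function_field (F : fieldType) : Prop :=
  exists2 p : nat, prime p &
  exists (f : {rmorphism {fraction {poly 'F_p}} -> F}) (n : nat)
         (b : 'I_n -> F),
    forall x : F, exists c : 'I_n -> {fraction {poly 'F_p}},
      x = \sum_(i < n) f (c i) * b i.

(* Places are represented by their normalized discrete valuations. The value
   [pord 0 = 0] is a junk value standing for +oo, fixed so that a place is
   determined by the function [pord]. *)
Record place (F : fieldType) := Place {
  pord :> F -> int;
  pord0 : pord 0 = 0;
  pordM : forall x y, x != 0 -> y != 0 -> pord (x * y) = pord x + pord y;
  pordD : forall x y, x != 0 -> y != 0 -> x + y != 0 ->
    Num.min (pord x) (pord y) <= pord (x + y);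
  pord_uniformizer : exists2 x, x != 0 & pord x = 1 }.

Section RegularRing.
Variables (F : fieldType) (inf : place F).

Definition regular : {pred F} := fun x =>
  `[< forall v : place F, pord v <> pord inf -> x = 0 \/ 0 <= v x >].

Lemma pord1 (v : place F) : v 1 = 0.
Proof.
have /eqP := pordM v (oner_neq0 F) (oner_neq0 F).
by rewrite mulr1 -[X in X == _]addr0 (inj_eq (addrI _)) eq_sym => /eqP.
Qed.

Lemma pordN1 (v : place F) : v (-1) = 0.
Proof.
have n1 : -1 != 0 :> F by rewrite oppr_eq0 oner_neq0.
have := pordM v n1 n1; rewrite mulrNN mulr1 pord1 => /eqP.
by rewrite eq_sym -mulr2n mulrn_eq0 /= => /eqP.
Qed.

Lemma pordN (v : place F) x : v (- x) = v x.
Proof.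
have [->|x0] := eqVneq x 0; first by rewrite oppr0.
by rewrite -mulN1r pordM ?oppr_eq0 ?oner_neq0// pordN1 add0r.
Qed.

Lemma regular_subring : subring_closed regular.
Proof.
split=> [|x y /asboolP Ax /asboolP Ay|x y /asboolP Ax /asboolP Ay];
  apply/asboolP => v vinf; first by right; rewrite pord1.
- have [->|x0] := eqVneq x 0.
    rewrite add0r pordN; case: (Ay v vinf) => [->|]; first by left; rewrite oppr0.
    by right.
  have [->|y0] := eqVneq y 0; first by rewrite subr0; exact: Ax.
  have [->|xy0] := eqVneq (x - y) 0; [by left|right].
  apply: le_trans (pordD _ x0 _ xy0); last by rewrite oppr_eq0.
  rewrite le_min pordN.
  by case: (Ax v vinf) => [/eqP|->]; [rewrite (negPf x0)|];
     case: (Ay v vinf) => [/eqP|->]; rewrite ?(negPf y0).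
- have [->|x0] := eqVneq x 0; first by left; rewrite mul0r.
  have [->|y0] := eqVneq y 0; first by left; rewrite mulr0.
  right; rewrite pordM// addr_ge0//.
    by case: (Ax v vinf) => // /eqP; rewrite (negPf x0).
  by case: (Ay v vinf) => // /eqP; rewrite (negPf y0).
Qed.

HB.instance Definition _ := GRing.isSubringClosed.Build F regular regular_subring.

Record regular_ring := RegularRing {
  regular_val :> F; regular_valP : regular_val \in regular }.

HB.instance Definition _ := [isSub for regular_val].
HB.instance Definition _ := [Choice of regular_ring by <:].
HB.instance Definition _ := [SubChoice_isSubComNzRing of regular_ring by <:].

End RegularRing.

Section AbsoluteValues.
Variable R : realType.

Record absval (K : fieldType) := AbsVal {
  absv :> K -> R;
  absv_ge0 : forall x, 0 <= absv x;
  absv_eq0 : forall x, absv x = 0 <-> x = 0;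
  absvM : forall x y, absv (x * y) = absv x * absv y;
  absvD : forall x y, absv (x + y) <= Num.max (absv x) (absv y) }.

(* |x| = c ^ (- v x); the choice of c > 1 is a normalization. *)
Definition place_abs (F : fieldType) (c : R) (v : place F) (x : F) : R :=
  if x == 0 then 0 else c ^ (- v x).

Definition absval_complete (K : fieldType) (a : absval K) : Prop :=
  forall u : nat -> K,
    (forall e : R, 0 < e -> exists n0 : nat, forall m n : nat,
      (n0 <= m)%N -> (n0 <= n)%N -> a (u m - u n) < e) ->
    exists l : K, forall e : R, 0 < e -> exists n0 : nat, forall n : nat,
      (n0 <= n)%N -> a (u n - l) < e.

Definition is_completion (K L : fieldType) (a : K -> R) (b : absval L)
    (f : {rmorphism K -> L}) : Prop :=
  [/\ forall x, b (f x) = a x,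
      forall (y : L) (e : R), 0 < e -> exists x : K, b (y - f x) < e
    & absval_complete b].

Definition is_algebraic_closure (K L : fieldType) (f : {rmorphism K -> L}) :
    Prop :=
  GRing.closed_field_axiom L /\ forall y : L, algebraicOver f y.

(* [C], with the absolute value [aC] and the embedding [iota] of [F], is a
   completion of an algebraic closure [Fbar] of a completion [Finf] of [F] at
   the place [inf]. *)
Definition is_C_infty (F : fieldType) (inf : place F) (C : fieldType)
    (aC : absval C) (iota : {rmorphism F -> C}) : Prop :=
  exists (c : R) (Finf Fbar : fieldType) (ainf : absval Finf)
      (abar : absval Fbar) (f1 : {rmorphism F -> Finf})
      (f2 : {rmorphism Finf -> Fbar}) (f3 : {rmorphism Fbar -> C}),
    [/\ 1 < c, is_completion (place_abs c inf) ainf f1,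
        is_algebraic_closure f2 /\ (forall x, abar (f2 x) = ainf x),
        is_completion abar aC f3
      & forall x, iota x = f3 (f2 (f1 x))].

End AbsoluteValues.

(* The ring [E] as an [R]-module through [f]. *)
Definition module_along (R E : nzRingType) (f : {rmorphism R -> E}) : Type := E.

Section ModuleAlong.
Variables (R E : nzRingType) (f : {rmorphism R -> E}).

HB.instance Definition _ := GRing.Zmodule.copy (module_along f) E.

Definition along_scale (a : R) (x : module_along f) : module_along f :=
  (f a * (x : E) : E).

Fact along_scaleA a b x : along_scale a (along_scale b x) = along_scale (a * b) x.
Proof. by rewrite /along_scale rmorphM mulrA. Qed.

Fact along_scale1 : left_id 1 along_scale.
Proof. by move=> x; rewrite /along_scale rmorph1 mul1r. Qed.

Fact along_scaleDr : right_distributive along_scale +%R.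
Proof. by move=> a x y; rewrite /along_scale mulrDr. Qed.

Fact along_scaleDl x : {morph along_scale^~ x : a b / a + b}.
Proof. by move=> a b; rewrite /along_scale rmorphD mulrDl. Qed.

HB.instance Definition _ := GRing.Zmodule_isLmodule.Build R (module_along f)
  along_scaleA along_scale1 along_scaleDr along_scaleDl.

End ModuleAlong.

Section FreeSubmodules.
Variables (R : nzRingType) (V : lmodType R).

Definition is_submodule (U : set V) : Prop :=
  U 0 /\ forall (a : R) (x y : V), U x -> U y -> U (a *: x + y).

Definition free_submodule (s : nat) (U : set V) : Prop :=
  is_submodule U /\
  exists b : 'I_s -> V, (forall i, U (b i)) /\
    forall x, U x -> exists! a : {ffun 'I_s -> R}, x = \sum_i a i *: b i.

Definition finitely_generated (U : set V) : Prop :=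
  exists (n : nat) (g : 'I_n -> V), (forall i, U (g i)) /\
    forall x, U x -> exists a : 'I_n -> R, x = \sum_i a i *: g i.

(* The rank of a submodule of a module over an integral domain: the number of
   elements of a maximal linearly independent family. *)
Definition has_rank (U : set V) (s : nat) : Prop :=
  exists b : 'I_s -> V,
    [/\ forall i, U (b i),
        forall a : 'I_s -> R, \sum_i a i *: b i = 0 -> forall i, a i = 0
      & forall x, U x -> exists (d : R) (a : 'I_s -> R),
          d != 0 /\ d *: x = \sum_i a i *: b i].

End FreeSubmodules.

(* Pairs Q <= P of submodules with N P <= Q, so that P / Q is an A/N-module. *)
Record subquotient (A : comNzRingType) (N : idealr A) (V : lmodType A) :=
  SubQuotient {
    sq_top : set V;
    sq_bot : set V;
    sq_topP : is_submodule sq_top;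
    sq_botP : is_submodule sq_bot;
    sq_sub : sq_bot `<=` sq_top;
    sq_kill : forall a x, a \in N -> sq_top x -> sq_bot (a *: x) }.

Section SubQuotient.
Variables (A : comNzRingType) (N : idealr A) (V : lmodType A).
Variable D : subquotient N V.

Definition sq_top_pred : {pred V} := fun x => `[< sq_top D x >].

Fact sq_top_closed : submod_closed sq_top_pred.
Proof.
case: (sq_topP D) => P0 PD; split; first exact/asboolP.
by move=> a x y /asboolP Px /asboolP Py; apply/asboolP; exact: PD.
Qed.

HB.instance Definition _ :=
  GRing.isSubmodClosed.Build A V sq_top_pred sq_top_closed.

Record sq_topmod := SqTop {
  sq_val :> V; sq_valP : sq_val \in sq_top_pred }.

HB.instance Definition _ := [isSub for sq_val].
HB.instance Definition _ := [Choice of sq_topmod by <:].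
HB.instance Definition _ := [SubChoice_isSubLmodule of sq_topmod by <:].

Definition sq_bot_pred : {pred sq_topmod} := fun x => `[< sq_bot D (val x) >].

Fact sq_bot_closed : submod_closed sq_bot_pred.
Proof.
case: (sq_botP D) => Q0 QD; split; first by apply/asboolP; rewrite raddf0.
move=> a x y /asboolP Qx /asboolP Qy; apply/asboolP.
by rewrite linearP; exact: QD.
Qed.

HB.instance Definition _ :=
  GRing.isSubmodClosed.Build A sq_topmod sq_bot_pred sq_bot_closed.

(* P / Q, on which A/N acts through representatives in A. *)
Definition sqmod : Type := Quotient.quot sq_bot_pred.

HB.instance Definition _ := GRing.Zmodule.on sqmod.

Definition sq_class (x : sq_topmod) : sqmod := \pi_(Quotient.quot sq_bot_pred) x.

Definition sq_scale (a : {ideal_quot N}) (m : sqmod) : sqmod :=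
  sq_class (repr a *: repr (m : Quotient.quot sq_bot_pred)).

Lemma sq_classP x y : sq_class x = sq_class y <-> sq_bot D (val x - val y).
Proof.
rewrite /sq_class; split=> [/eqP|Q].
  by rewrite eqquotE /Quotient.equiv => /asboolP; rewrite raddfB.
by apply/eqP; rewrite eqquotE /Quotient.equiv; apply/asboolP; rewrite raddfB.
Qed.

Lemma sq_class_repr (m : sqmod) : sq_class (repr (m : Quotient.quot sq_bot_pred)) = m.
Proof. exact: reprK. Qed.

Lemma sq_classD x y : sq_class (x + y) = sq_class x + sq_class y.
Proof. exact: raddfD. Qed.

Lemma sq_scaleE (a : A) x :
  sq_scale (\pi_{ideal_quot N} a) (sq_class x) = sq_class (a *: x).
Proof.
apply/sq_classP.
set b := repr _; set y := repr _.
have bN : b - a \in N.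
  have : \pi_{ideal_quot N} b = \pi_{ideal_quot N} a by rewrite reprK.
  by move/eqP; rewrite eqquotE /Quotient.equiv.
have yQ : sq_bot D (val y - val x).
  by apply/sq_classP; rewrite sq_class_repr.
have Px : sq_top D (val x) by apply/asboolP; exact: valP x.
have -> : val (b *: y) - val (a *: x)
          = b *: (val y - val x) + (1 *: ((b - a) *: val x) + 0).
  have aux (u w : V) :
      b *: u - a *: w = b *: (u - w) + (1 *: ((b - a) *: w) + 0).
    by rewrite scale1r addr0 scalerBr scalerBl addrA subrK.
  exact: aux.
have [Q0 QD] := sq_botP D.
by apply: (QD) => //; apply: (QD) => //; exact: sq_kill.
Qed.

Fact sq_scaleA a b m : sq_scale a (sq_scale b m) = sq_scale (a * b) m.
Proof.
elim/quotW: a => a; elim/quotW: b => b; rewrite -[m]sq_class_repr.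
have -> : \pi_{ideal_quot N} a * \pi_{ideal_quot N} b
          = \pi_{ideal_quot N} (a * b) by rewrite rmorphM.
by rewrite (sq_scaleE b) (sq_scaleE a) (sq_scaleE (a * b)) scalerA.
Qed.

Fact sq_scale1 : left_id 1 sq_scale.
Proof.
move=> m; rewrite -[m]sq_class_repr.
have -> : 1 = \pi_{ideal_quot N} 1 by rewrite rmorph1.
by rewrite sq_scaleE scale1r.
Qed.

Fact sq_scaleDr : right_distributive sq_scale +%R.
Proof.
elim/quotW=> a x y; rewrite -[x]sq_class_repr -[y]sq_class_repr.
by rewrite -sq_classD !sq_scaleE scalerDr sq_classD.
Qed.

Fact sq_scaleDl m : {morph sq_scale^~ m : a b / a + b}.
Proof.
elim/quotW=> a; elim/quotW=> b; rewrite -[m]sq_class_repr /=.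
have -> : \pi_{ideal_quot N} a + \pi_{ideal_quot N} b
          = \pi_{ideal_quot N} (a + b) by rewrite raddfD.
by rewrite !sq_scaleE scalerDl sq_classD.
Qed.

HB.instance Definition _ := GRing.Zmodule_isLmodule.Build {ideal_quot N} sqmod
  sq_scaleA sq_scale1 sq_scaleDr sq_scaleDl.

End SubQuotient.

Section Lattices.
Variables (F : fieldType) (inf : place F).
Local Notation A := (regular_ring inf).

Definition embA : {rmorphism A -> F} := \val.
Definition FA : Type := module_along embA.
HB.instance Definition _ := GRing.Lmodule.on FA.

Variable N : idealr A.

Definition inv_ideal : set F :=
  [set x | forall a : A, a \in N -> val a * x \in regular inf].

Fact inv_ideal_submodule : is_submodule (inv_ideal : set FA).
Proof.
split=> [a _|a x y Nx Ny b Nb]; first by rewrite mulr0 rpred0.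
rewrite mulrDr mulrCA rpredD ?Ny// rpredM ?Nx//; exact: valP.
Qed.

Fact regular_submodule : is_submodule ([set` regular inf] : set FA).
Proof.
split=> [|a x y Ax Ay] /=; first exact: rpred0.
by rewrite rpredD// rpredM//; exact: valP.
Qed.

Fact regular_sub_inv_ideal : ([set` regular inf] : set FA) `<=` inv_ideal.
Proof. by move=> x Ax a _; rewrite rpredM//; exact: valP. Qed.

Fact inv_ideal_kill (a : A) (x : FA) :
  a \in N -> inv_ideal x -> ([set` regular inf] : set FA) (a *: x).
Proof. by move=> Na Nx; exact: Nx. Qed.

Definition std_subquotient : subquotient N FA :=
  SubQuotient inv_ideal_submodule regular_submodule regular_sub_inv_ideal
    inv_ideal_kill.

(* N^-1 / A *)
Definition std_torsion : lmodType {ideal_quot N} := sqmod std_subquotient.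

Definition std_torsion_pow (s : nat) : lmodType {ideal_quot N} :=
  {ffun 'I_s -> std_torsion}.

Variables (R : realType) (C : fieldType) (aC : absval R C).
Variable iota : {rmorphism F -> C}.

Definition embAC : {rmorphism A -> C} := iota \o embA.
Definition CA : Type := module_along embAC.
HB.instance Definition _ := GRing.Lmodule.on CA.

Record lattice := Lattice {
  lattice_set :> set CA;
  lattice_submodule : is_submodule lattice_set;
  lattice_fg : finitely_generated lattice_set;
  lattice_discrete : forall (z : C) (rho : R),
    finite_set [set x : C | lattice_set x /\ aC (x - z) <= rho] }.

(* N^-1 L: the finite sums of products of elements of N^-1 and of L. *)
Definition inv_ideal_mul (L : set CA) : set CA :=
  [set z | exists (n : nat) (x : 'I_n -> F) (l : 'I_n -> C),
    [/\ forall i, inv_ideal (x i), forall i, L (l i)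
      & z = \sum_i iota (x i) * l i]].

Section Torsion.
Variable L : lattice.

Fact inv_ideal_mul_submodule : is_submodule (inv_ideal_mul L).
Proof.
split; first by exists 0, (fun=> 0), (fun=> 0); split=> [[]|[]|] //; rewrite big_ord0.
move=> a y z [n [x [l [Nx Ll ->]]]] [m [x' [l' [Nx' Ll' ->]]]].
exists (n + m)%N,
  (fun i => match fintype.split i with inl j => val a * x j | inr j => x' j end),
  (fun i => match fintype.split i with inl j => l j | inr j => l' j end).
split=> [i|i|].
- case: (fintype.split i) => j //.
  have [_ /(_ a (x j) 0 (Nx j))] := inv_ideal_submodule.
  move=> /(_ inv_ideal_submodule.1); rewrite addr0; exact.
- by case: (fintype.split i).
- rewrite big_split_ord /=; congr (_ + _).
    rewrite [LHS]mulr_sumr; apply: eq_bigr => j _.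
    by rewrite (unsplitK (inl j)) rmorphM mulrA.
  by apply: eq_bigr => j _; rewrite (unsplitK (inr j)).
Qed.

Fact lattice_sub_inv_ideal_mul : L `<=` inv_ideal_mul L.
Proof.
move=> z Lz; exists 1, (fun=> 1), (fun=> z); split=> //.
  by move=> _ a _; rewrite mulr1; exact: valP.
by rewrite big_ord1 rmorph1 mul1r.
Qed.

Fact inv_ideal_mul_kill (a : A) (z : CA) :
  a \in N -> inv_ideal_mul L z -> lattice_set L (a *: z).
Proof.
move=> Na [n [x [l [Nx Ll ->]]]].
have [L0 LD] := lattice_submodule L.
have -> : a *: (\sum_i iota (x i) * l i : CA)
        = \sum_i (RegularRing (Nx i a Na) *: (l i : CA)).
  rewrite [LHS]mulr_sumr; apply: eq_bigr => i _.
  rewrite [LHS]mulrA; congr (_ * _); exact: (esym (rmorphM iota (val a) (x i))).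
elim/big_ind: _ => // [y w Ly Lw|i _]; first by rewrite -[y]scale1r; exact: LD.
by rewrite -[X in lattice_set _ X]addr0; exact: LD.
Qed.

Definition lattice_subquotient : subquotient N CA :=
  SubQuotient inv_ideal_mul_submodule (lattice_submodule L)
    lattice_sub_inv_ideal_mul inv_ideal_mul_kill.

Definition lattice_torsion : lmodType {ideal_quot N} :=
  sqmod lattice_subquotient.

End Torsion.

(* The set L_N^s of pairs (Lambda, alpha). *)
Record level_lattice (s : nat) := LevelLattice {
  ll_lattice : lattice;
  ll_rank : has_rank ll_lattice s;
  ll_iso : std_torsion_pow s -> lattice_torsion ll_lattice;
  ll_linear : linear ll_iso;
  ll_bij : bijective ll_iso }.

(* The set of pairs (Lambda, iota) of a lattice of rank at most r and an
   injection of N^-1 Lambda / Lambda into (N^-1 / A)^r. *)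
Record inj_lattice (r : nat) := InjLattice {
  il_lattice : lattice;
  il_rank : exists2 s : nat, (s <= r)%N & has_rank il_lattice s;
  il_map : lattice_torsion il_lattice -> std_torsion_pow r;
  il_linear : linear il_map;
  il_inj : injective il_map }.

Definition Free (s r : nat) : Type :=
  {U : set (std_torsion_pow r) | free_submodule s U}.

Record injective_selection (r : nat) := InjectiveSelection {
  selection : forall s : 'I_r.+1, Free s r ->
    std_torsion_pow s -> std_torsion_pow r;
  selection_linear : forall (s : 'I_r.+1) (U : Free s r), linear (selection U);
  selection_inj : forall (s : 'I_r.+1) (U : Free s r), injective (selection U);
  selection_image : forall (s : 'I_r.+1) (U : Free s r),
    range (selection U) = sval U }.

Section Inverse.
Variables (s : nat) (x : level_lattice s).

Fact ll_inv_exists : exists g : lattice_torsion (ll_lattice x) -> std_torsion_pow s,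
  cancel (@ll_iso s x) g /\ cancel g (@ll_iso s x).
Proof. by case: (ll_bij x) => g ? ?; exists g. Qed.

Definition ll_inv : lattice_torsion (ll_lattice x) -> std_torsion_pow s :=
  sval (cid ll_inv_exists).

Lemma ll_isoK : cancel (@ll_iso s x) ll_inv.
Proof. by rewrite /ll_inv; case: cid => g []. Qed.

Lemma ll_invK : cancel ll_inv (@ll_iso s x).
Proof. by rewrite /ll_inv; case: cid => g []. Qed.

Lemma ll_inv_linear : linear ll_inv.
Proof.
move=> a u v; apply: (can_inj ll_isoK).
by rewrite ll_linear !ll_invK.
Qed.

End Inverse.
Arguments ll_inv {s} x _.

Section StratumMap.
Variables (r : nat) (delta : injective_selection r).
Variables (s : 'I_r.+1) (U : Free s r) (x : level_lattice s).

Definition stratum_fun : lattice_torsion (ll_lattice x) -> std_torsion_pow r :=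
  selection delta U \o ll_inv x.

Fact stratum_linear : linear stratum_fun.
Proof. by move=> a u v; rewrite /stratum_fun /= ll_inv_linear selection_linear. Qed.

Fact stratum_inj : injective stratum_fun.
Proof.
move=> u v /(@selection_inj _ delta s U) uv.
by rewrite -[u](ll_invK (x := x)) uv ll_invK.
Qed.

Fact stratum_rank : exists2 t : nat, (t <= r)%N & has_rank (ll_lattice x) t.
Proof. by exists s; [rewrite -ltnS | exact: ll_rank]. Qed.

Definition stratum_map : inj_lattice r :=
  InjLattice stratum_rank stratum_linear stratum_inj.

End StratumMap.

(* The disjoint union of copies of L_N^s over s <= r and U in Free_N^{s,r}. *)
Definition strata (r : nat) : Type :=
  {sU : {s : 'I_r.+1 & Free s r} & level_lattice (projT1 sU)}.

Definition strata_map (r : nat) (delta : injective_selection r)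
    (x : strata r) : inj_lattice r :=
  stratum_map delta (projT2 (projT1 x)) (projT2 x).

End Lattices.

(* Main.v *)
Require Import Defs.
From HB Require Import structures.
From mathcomp Require Import all_boot all_order all_algebra.
From mathcomp Require Import generic_quotient ring_quotient.
From mathcomp Require Import zify ring.
From mathcomp Require Import boolp classical_sets functions cardinality reals.

(** Write T(L) for N^-1 L / L.  Everything rests on one algebraic fact,
    [lattice_torsion_free]: for a lattice L of rank s the module T(L) is free
    of rank s over A/N.  Granting it, the inverse of the map sends (L, j) to
    the copy indexed by U = Im j, which is free of rank s because j is
    injective, with alpha = j^-1 o delta_U; and U, s and alpha can be read off
    (L, delta_U o alpha^-1), since U is the image of the injection, s is
    the rank of L and delta_U is injective.

    The freeness is local at N.  The ring A is a Dedekind domain, so the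
    semilocal ring B = (1 + N)^-1 A is a principal ideal ring.  Over B the
    lattice L acquires a basis b_1, ..., b_s (a Hermite form,
    [lattice_local_basis]) and N acquires a generator z with an approximate
    inverse w in N^-1 ([ideal_near_generator]); up to a factor in 1 + N, the
    elements w b_i then form a basis of T(L) over A/N.

    The Dedekind property is reached through two facts about A which avoid
    differents, integral closures and any supply of places.

    - Every quotient A/aA with a nonzero is finite ([finite_quotient]).
      Clearing denominators in F over F_q[t], the sums of a^i x_i over i < D
      with the x_i in a set of M elements lie in a set of size q^(nc D + O(1)),
      where c depends on a only; for M = 2 q^(nc) and D large two of these
      M^D sums agree, and the first place where they differ exhibits two of
      the M elements congruent modulo a.

    - A is completely integrally closed, being an intersection of discrete
      valuation rings ([regular_completely_integrally_closed]).

    Given x, y in A, let I = (x, y).  If I I^-1 were a proper ideal J, then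
    finiteness of A/xA would give r outside xA with r J inside xA
    ([quotient_annihilator]); then r/x multiplies I^-1 into itself, so r/x is
    in A, a contradiction.  Hence x u + y v = 1 with u, v in I^-1
    ([inverse_pair]), and a power of x u that is idempotent modulo an element
    of N patches x and y into one element generating I B
    ([bezout_mem]). *)

Set Implicit Arguments.
Unset Strict Implicit.
Unset Printing Implicit Defensive.

Import Order.TTheory GRing.Theory Num.Theory.
Local Open Scope ring_scope.

(** * Finiteness of the quotients A/aA *)

Definition completely_integrally_closed (F : fieldType) (A : {pred F}) : Prop :=
  forall u g : F, g != 0 -> (forall k, u ^+ k * g \in A) -> u \in A.

(** For nonzero a in A the list s is a finite system of representatives of
    A/aA; congruence modulo a is written as divisibility inside F. *)
Definition finite_quotients (F : fieldType) (A : {pred F}) : Prop :=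
  forall a, a \in A -> a != 0 ->
  exists s : seq F, {subset s <= A} /\
    forall x, x \in A -> exists2 y, y \in s & (x - y) / a \in A.

Section FiniteQuotient.
Variables (K : finFieldType) (F : fieldType) (e : {rmorphism {poly K} -> F}).
Hypothesis e_inj : injective e.
Variables (n : nat) (b : 'I_n -> F).
Hypothesis b_span : forall x : F, exists (q : {poly K}) (P : 'I_n -> {poly K}),
  q != 0 /\ e q * x = \sum_i e (P i) * b i.

(** The F_q-subspace of F spanned by the e(X)^k b_i with k < L; it has at most
    q^(nL) elements, whether or not the b_i are independent. *)
Definition spanned (L : nat) (y : F) : Prop :=
  exists P : 'I_n -> {poly K},
    (forall i, (size (P i) <= L)%N) /\ y = \sum_i e (P i) * b i.

Lemma spanned_mono L L' y : (L <= L')%N -> spanned L y -> spanned L' y.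
Proof. by move=> LL' [P [sP ->]]; exists P; split=> // i; exact: leq_trans LL'. Qed.

Lemma spanned_sum L (I : finType) (y : I -> F) :
  (forall i, spanned L (y i)) -> spanned L (\sum_i y i).
Proof.
move=> /choice[P HP]; exists (fun j => \sum_i P i j); split=> [j|].
  by apply/(leq_trans (size_sum _ _ _))/bigmax_leqP => i _; exact: (HP i).1.
rewrite (eq_bigr _ (fun i _ => (HP i).2)) exchange_big /=.
by apply: eq_bigr => j _; rewrite rmorph_sum mulr_suml.
Qed.

Lemma spanned_mul L L' (q : {poly K}) y :
  (size q <= L')%N -> spanned L y -> spanned (L + L') (e q * y).
Proof.
move=> sq [P [sP ->]]; exists (fun i => q * P i); split=> [i|].
  apply: leq_trans (size_polyMleq _ _) _; apply: leq_trans (leq_pred _) _.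
  by rewrite addnC leq_add.
by rewrite mulr_sumr; apply: eq_bigr => i _; rewrite rmorphM mulrA.
Qed.

Lemma spanned_denominator (I : finType) (x : I -> F) :
  exists (q : {poly K}) (L : nat), q != 0 /\ forall i, spanned L (e q * x i).
Proof.
have /choice[d Hd] i := b_span (x i); have /choice[P HP] := Hd.
pose L := (\max_i \max_j size (P i j) + \max_i size (\prod_(j | j != i) d j)%R)%N.
exists (\prod_i d i), L; split.
  by apply/prodf_neq0 => i _; exact: (HP i).1.
move=> i; rewrite (bigD1 i)//= [d i * _]mulrC rmorphM -mulrA; apply: spanned_mul.
  exact: (leq_bigmax (F := fun i => size (\prod_(j | j != i) d j)) i).
exists (P i); split=> [j|]; last exact: (HP i).2.
apply: leq_trans (leq_bigmax (F := fun i => (\max_j size (P i j))%N) i).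
exact: (leq_bigmax (F := fun j => size (P i j)) j).
Qed.

(** Multiplication by a enlarges the degree of coordinates by a constant c that
    depends on a alone, once a denominator q is cleared. This linear growth is
    what bounds A/aA. *)
Lemma spanned_growth (a : F) : exists (q : {poly K}) (c : nat), q != 0 /\
  forall L y, spanned L y ->
    spanned (L + c) (e q * y) /\ spanned (L + c) (e q * a * y).
Proof.
have [q [L0 [q0 HM]]] := spanned_denominator (fun i => a * b i).
exists q, (maxn (size q) L0); split=> // L y Ly; split.
  by apply: spanned_mul => //; exact: leq_maxl.
have [P [sP ->]] := Ly.
rewrite mulr_sumr; apply: spanned_sum => i.
rewrite mulrCA -mulrA addnC.
apply: spanned_mul; first exact: sP.
apply: spanned_mono (HM i); exact: leq_maxr.
Qed.

(** The bound is M = 2 q^(nc), with c the growth constant of a. The M^D sums of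
    a^i x_(phi i), i < D, have q^(n (c1 + D c)) possible values, where c1
    depends on the family x; the factor 2^D beats q^(n c1) for D = q^(n c1).
    Two sums then coincide, and cancelling a^k, for k the first index at which
    the two choices phi and psi differ, shows that x_(phi k) - x_(psi k) is a
    multiple of a. *)
Lemma congruent_pair (A : subringClosed F) (a : F) : a \in A -> a != 0 ->
  exists M : nat, forall x : 'I_M -> F, (forall i, x i \in A) ->
    exists i j, i != j /\ (x i - x j) / a \in A.
Proof.
move=> Aa a0; have [q [c [q0 grow]]] := spanned_growth a.
pose Q := #|K|; have Q0 : (0 < Q)%N by apply/card_gt0P; exists 0.
exists (2 * Q ^ (n * c))%N => x Ax.
have [q1 [c1 [q10 x_span]]] := spanned_denominator x.
pose D := (Q ^ (n * c1))%N.
pose S (phi : {ffun 'I_D -> 'I_(2 * Q ^ (n * c))}) : F :=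
  \sum_(i < D) a ^+ i * x (phi i).
pose L := (c1 + D * c)%N.
have S_span phi : spanned L (e q ^+ D * e q1 * S phi).
  rewrite mulr_sumr; apply: spanned_sum => i.
  (* Each of the D factors is spent either on q alone or on q a, at the same
     cost c. *)
  have step k m y l : spanned l y ->
      spanned (l + (k + m) * c) (e q ^+ k * ((e q * a) ^+ m * y)).
    move=> ly; elim: k => [|k IH].
      rewrite expr0 mul1r add0n; elim: m => [|m IH].
        by rewrite expr0 mul1r mul0n addn0.
      by rewrite exprS -mulrA mulSn addnCA addnC; exact: (grow _ _ IH).2.
    by rewrite exprS -mulrA addSn mulSn addnCA addnC; exact: (grow _ _ IH).1.
  have := step (D - i)%N (nat_of_ord i) _ _ (x_span (phi i)).
  rewrite subnK; last exact: ltnW.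
  suff -> : e q ^+ D * e q1 * (a ^+ i * x (phi i))
    = e q ^+ (D - i) * ((e q * a) ^+ i * (e q1 * x (phi i))) by [].
  have -> : e q ^+ D = e q ^+ (D - i) * e q ^+ i by rewrite -exprD subnK// ltnW.
  by rewrite exprMn; ring.
have {S_span} [P HP] := choice S_span.
pose code phi : 'M[K]_(n, L) := \matrix_(i, j) (P phi i)`_j.
have code_inj phi psi : code phi = code psi -> S phi = S psi.
  move=> /matrixP E.
  have PE i : P phi i = P psi i.
    apply/polyP => j; have [jL|Lj] := ltnP j L.
      by have := E i (Ordinal jL); rewrite !mxE.
    by rewrite !nth_default // (leq_trans _ Lj)//; case: (HP phi) (HP psi) => ? _ [].
  have nz : e q ^+ D * e q1 != 0.
    by rewrite mulf_neq0 ?expf_neq0 // -(rmorph0 e) (inj_eq e_inj).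
  apply: (mulfI nz); rewrite (HP phi).2 (HP psi).2.
  by apply: eq_bigr => i _; rewrite PE.
have card_lt : (#|{: 'M[K]_(n, L)}| < #|{ffun 'I_D -> 'I_(2 * Q ^ (n * c))}|)%N.
  rewrite card_mx card_ffun !card_ord expnMn -expnM -/Q mulnDr expnD -/D.
  have -> : (n * (D * c) = n * c * D)%N by rewrite -mulnA [(D * c)%N]mulnC.
  rewrite ltn_pmul2r.
    exact: ltn_expl.
  by rewrite expn_gt0 Q0.
have /injectivePn[phi [psi neq E]] : ~~ injectiveb code.
  by apply/negP => /injectiveP /leq_card; rewrite leqNgt card_lt.
have {E} SE := code_inj _ _ E.
have [i Hi] : exists i, phi i != psi i.
  by apply/existsP; apply: contra_neqT neq; rewrite negb_exists => /forallP H;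
     apply/ffunP => i; have := H i; rewrite negbK => /eqP.
case: (@arg_minnP _ i (fun i => phi i != psi i) (fun i => nat_of_ord i) Hi)
  => {Hi} k Hk kmin.
exists (phi k), (psi k); split=> //.
pose T (chi : {ffun 'I_D -> 'I_(2 * Q ^ (n * c))}) :=
  \sum_(i < D | (k < i)%N) a ^+ (i - k.+1) * x (chi i).
have ST chi : S chi = \sum_(i < D | (i < k)%N) a ^+ i * x (chi i)
    + a ^+ k * (x (chi k) + a * T chi).
  rewrite /S (bigID (fun i : 'I_D => (i < k)%N)) /=; congr (_ + _).
  rewrite (bigD1 k) ?ltnn//= mulrDr; congr (_ + _).
  rewrite mulrA -exprSr mulr_sumr; apply: eq_big => [l|l Hl].
    by rewrite -leqNgt [RHS]ltn_neqAle andbC -val_eqE eq_sym.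
  rewrite mulrA -exprD subnKC //.
  by move: Hl; rewrite -leqNgt andbC -val_eqE eq_sym -ltn_neqAle.
have pre : \sum_(i < D | (i < k)%N) a ^+ i * x (phi i)
    = \sum_(i < D | (i < k)%N) a ^+ i * x (psi i).
  apply: eq_bigr => l lk; suff -> : phi l = psi l by [].
  by apply: contraTeq lk => /kmin; rewrite -leqNgt.
move: SE; rewrite !ST pre => /addrI /(mulfI (expf_neq0 _ a0)) E.
have -> : (x (phi k) - x (psi k)) / a = T psi - T phi.
  apply: (mulIf a0); rewrite divfK//.
  apply/eqP; rewrite subr_eq -(inj_eq (addIr (a * T phi))) E; apply/eqP; ring.
have AT chi : T chi \in A.
  by apply: rpred_sum => l _; rewrite rpredM ?rpredX.
by rewrite rpredB.
Qed.

(** Incongruent families in A have fewer than M members, so extending one as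
    long as possible ends with a system of representatives. *)
Lemma finite_quotient (A : subringClosed F) : finite_quotients A.
Proof.
move=> a Aa a0; have [M HM] := congruent_pair Aa a0.
pose good (s : seq F) := {subset s <= A} /\
  forall i j, (i < j < size s)%N -> (s`_j - s`_i) / a \notin A.
suff H m s : (M <= m + size s)%N -> good s -> exists s : seq F,
    {subset s <= A} /\
    forall x, x \in A -> exists2 y, y \in s & (x - y) / a \in A.
  by apply: (H M [::]); [rewrite addn0|split=> // i j; rewrite andbF].
elim: m s => [|m IH] s sM [sA sgood].
  have [i|i [j [ij Hij]]] := HM (fun i => s`_i).
    by apply/sA/mem_nth/(leq_trans (ltn_ord i) sM).
  have sz (l : 'I_M) : (l < size s)%N := leq_trans (ltn_ord l) sM.
  have [lt|lt|/val_inj E] := ltngtP i j; last by rewrite E eqxx in ij.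
    have /sgood/negP[] : (i < j < size s)%N by rewrite lt sz.
    by rewrite -opprB mulNr rpredN.
  by have /sgood/negP[] : (j < i < size s)%N by rewrite lt sz.
have [H|/existsNP[x /not_implyP[Ax Hx]]] := pselect (forall x, x \in A ->
  exists2 y, y \in s & (x - y) / a \in A); first by exists s.
apply: (IH (rcons s x)); first by rewrite size_rcons addnS.
split=> [y|i j]; first by rewrite mem_rcons inE => /predU1P[->//|/sA].
rewrite size_rcons ltnS => /andP[ij]; rewrite leq_eqVlt => /predU1P[jE|js].
  rewrite !nth_rcons -jE ij ltnn eqxx; apply/negP => bad; apply: Hx.
  by exists s`_i => //; rewrite mem_nth // -jE.
by rewrite !nth_rcons js (ltn_trans ij js); apply: sgood; rewrite ij.
Qed.

End FiniteQuotient.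

(** * Invertibility of two-generated ideals *)

Section Dedekind.
Variables (F : fieldType) (A : subringClosed F).

Hypothesis A_cic : completely_integrally_closed A.
Hypothesis A_fin : finite_quotients A.

(** In the finite ring A/aA the powers of p are eventually periodic, from
    exponent i on with period t say; the exponent k = t i is then at least i
    and a multiple of t, so p^k = p^(2k). *)
Lemma idempotent_power (a p : F) : a \in A -> a != 0 -> p \in A ->
  exists2 k, (0 < k)%N & p ^+ k * (1 - p ^+ k) / a \in A.
Proof.
move=> Aa a0 Ap; have [s [sA s_rep]] := A_fin Aa a0.
have /choice[r Hr] (i : nat) :
    exists y, y \in s /\ (p ^+ i.+1 - y) / a \in A.
  by have [|y] := s_rep (p ^+ i.+1); [exact: rpredX | exists y].
have /(uniqPn 0)[i [j [ij]]] : ~~ uniq [seq r i | i <- iota 0 (size s).+1].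
  apply/negP => /uniq_leq_size H.
  have sub : {subset [seq r i | i <- iota 0 (size s).+1] <= s}.
    by move=> _ /mapP[i _ ->]; case: (Hr i).
  by have := H s sub; rewrite size_map size_iota ltnn.
rewrite size_map size_iota => js.
rewrite !(nth_map 0%N) ?size_iota ?(ltn_trans ij)// !nth_iota ?(ltn_trans ij)//.
rewrite !add0n => E.
have [t tE] : exists t, j.+1 = (i.+1 + t.+1)%N.
  exists (j - i).-1.
  by rewrite prednK ?subn_gt0// addSn subnKC// ltnW.
have D1 : p ^+ i.+1 * (1 - p ^+ t.+1) / a \in A.
  rewrite mulrBr mulr1 -exprD -tE.
  have -> : (p ^+ i.+1 - p ^+ j.+1) / a
    = (p ^+ i.+1 - r i) / a - (p ^+ j.+1 - r j) / a.
    by rewrite E -mulrBl; congr (_ / _); ring.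
  by rewrite rpredB //; case: (Hr i) (Hr j) => ? ? [].
exists (t.+1 * i.+1)%N; first by rewrite muln_gt0.
have -> : p ^+ (t.+1 * i.+1) * (1 - p ^+ (t.+1 * i.+1)) / a
  = p ^+ (t * i.+1) * (\sum_(l < i.+1) (p ^+ t.+1) ^+ l)
    * (p ^+ i.+1 * (1 - p ^+ t.+1) / a).
  rewrite [in 1 - _]exprM.
  have -> : 1 - (p ^+ t.+1) ^+ i.+1
     = (1 - p ^+ t.+1) * \sum_(l < i.+1) (p ^+ t.+1) ^+ l.
    by rewrite -opprB subrX1 -mulNr opprB.
  rewrite mulSn exprD; move: (\sum_(_ < _) _) (p ^+ (_ * _)) => u v.
  by field.
by rewrite rpredM// rpredM ?rpredX// rpred_sum// => l _; rewrite !rpredX.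
Qed.

Definition ideal_of (J : set F) : Prop :=
  [/\ forall x, J x -> x \in A, J 0
    & forall c x y, c \in A -> J x -> J y -> J (c * x + y)].

Lemma idealM J c x : ideal_of J -> c \in A -> J x -> J (c * x).
Proof. by case=> _ J0 JD Ac Jx; rewrite -[_ * _]addr0; exact: JD. Qed.

Lemma idealD J x y : ideal_of J -> J x -> J y -> J (x + y).
Proof. by case=> _ J0 JD Jx Jy; rewrite -[x]mul1r; apply: JD; rewrite ?rpred1. Qed.

(** An ideal containing j is generated by j and the representatives modulo j
    that it contains. *)
Lemma ideal_fg J j : ideal_of J -> J j -> j != 0 ->
  exists s : seq F, (forall y, y \in s -> J y) /\
    forall x, J x -> exists2 y, y \in s & (x - y) / j \in A.
Proof.
move=> idJ Jj j0; have [JA J0 JD] := idJ; have [s [sA s_rep]] := A_fin (JA _ Jj) j0.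
exists [seq y <- s | `[< J y >]]; split=> [y|x Jx].
  by rewrite mem_filter => /andP[/asboolP].
have [y ys xy] := s_rep x (JA _ Jx); exists y => //.
rewrite mem_filter ys andbT; apply/asboolP.
have -> : y = (- ((x - y) / j)) * j + x by rewrite mulNr divfK// opprB subrK.
by apply: JD; rewrite ?rpredN.
Qed.

(** A proper ideal of the finite ring A/jA has a nonzero annihilator. The
    product r0 of the 1 - y^k, for y among generators of J and y^k idempotent,
    is nonzero because it is 1 modulo J, and each y is nilpotent on it.
    Multiplying r0 by each y as often as the result stays nonzero produces an
    element that all of J kills. *)
Lemma quotient_annihilator J j : ideal_of J -> J j -> j != 0 -> ~ J 1 ->
  exists r, [/\ r \in A, r / j \notin A & forall x, J x -> r * x / j \in A].
Proof.
move=> idJ Jj j0 J1; have [JA J0 JD] := idJ.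
have Aj := JA _ Jj.
have [s [sJ s_rep]] := ideal_fg idJ Jj j0.
have [r0 [Jr0 r0s]] : exists r0, J (1 - r0) /\
    forall y, y \in s -> exists k, r0 * y ^+ k / j \in A.
  elim: s sJ {s_rep} => [|y s IH] sJ; first by exists 1; rewrite subrr.
  have [|r0 [Jr0 r0s]] := IH; first by move=> z zs; apply: sJ; rewrite inE zs orbT.
  have Jy : J y by apply: sJ; rewrite inE eqxx.
  have [k k0 Hk] := idempotent_power Aj j0 (JA _ Jy).
  have Ar0 : r0 \in A by rewrite -[r0](subKr 1) rpredB ?rpred1// JA.
  exists (r0 * (1 - y ^+ k)); split.
    have -> : 1 - r0 * (1 - y ^+ k) = (r0 * y ^+ k.-1) * y + (1 - r0).
      by rewrite -mulrA -exprSr prednK//; ring.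
    by apply: JD => //; rewrite rpredM// rpredX// JA.
  move=> z; rewrite inE => /predU1P[->|/r0s[l Hl]].
    exists k; have -> : r0 * (1 - y ^+ k) * y ^+ k / j
      = r0 * (y ^+ k * (1 - y ^+ k) / j) by ring.
    by rewrite rpredM.
  exists l; have -> : r0 * (1 - y ^+ k) * z ^+ l / j
    = (1 - y ^+ k) * (r0 * z ^+ l / j) by ring.
  by rewrite rpredM// rpredB ?rpred1 ?rpredX ?JA.
have Ar0 : r0 \in A by rewrite -[r0](subKr 1) rpredB ?rpred1// JA.
have r0j : r0 / j \notin A.
  apply/negP => H; apply: J1; rewrite -[1](subrK r0) addrC.
  by rewrite -[r0 in X in X + _](divfK j0); apply: JD.
have sA : {subset s <= A} by move=> y /sJ /JA.
suff [m [Am rj rs]] : exists m, [/\ m \in A, r0 * m / j \notin A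
    & forall y, y \in s -> r0 * m * y / j \in A].
  exists (r0 * m); split=> // [|x Jx]; first by rewrite rpredM.
  have [y ys xy] := s_rep x Jx.
  have -> : r0 * m * x / j = r0 * m * y / j + r0 * m * ((x - y) / j) by field.
  by rewrite rpredD// ?rs// rpredM// rpredM.
elim: s r0 {sJ Jr0 s_rep} sA Ar0 r0j r0s => [|y s IH] r sA Ar rj r0s.
  by exists 1; rewrite mulr1 rpred1.
have Ay : y \in A by apply: sA; rewrite mem_head.
have Hk0 := r0s y (mem_head _ _).
case: (ex_minnP Hk0) => k Hk kmin.
case: k Hk kmin => [|k] Hk kmin; first by rewrite expr0 mulr1 (negPf rj) in Hk.
have [||||m [Am r'j r's]] := IH (r * y ^+ k).
- by move=> z zs; apply: sA; rewrite inE zs orbT.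
- by rewrite rpredM ?rpredX.
- by apply/negP => /kmin; rewrite ltnn.
- move=> z zs; have [|l Hl] := r0s z; first by rewrite inE zs orbT.
  exists l; have -> : r * y ^+ k * z ^+ l / j = y ^+ k * (r * z ^+ l / j) by ring.
  by rewrite rpredM ?rpredX.
exists (y ^+ k * m); rewrite rpredM ?rpredX// mulrA; split=> // z.
rewrite inE => /predU1P[->|/r's//].
have -> : r * y ^+ k * m * y / j = m * (r * y ^+ k.+1 / j) by rewrite exprS; ring.
by rewrite rpredM.
Qed.

(** The ideal I = (x, y) is invertible: here [inv u] says u is in I^-1 and J is
    I I^-1. If J is proper, r/x maps I^-1 into itself for an annihilator r of J
    modulo x, so all x (r/x)^k are in A and r/x is in A by complete integral
    closedness, although r is not in xA. *)
Lemma inverse_pair_neq0 x y : x \in A -> y \in A -> x != 0 ->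
  exists u v, x * u + y * v = 1 /\
    [/\ x * u \in A, y * u \in A, x * v \in A & y * v \in A].
Proof.
move=> Ax Ay x0.
pose inv u := x * u \in A /\ y * u \in A.
have invD c u u' : c \in A -> inv u -> inv u' -> inv (c * u + u').
  by move=> Ac [? ?] [? ?]; split; rewrite mulrDr mulrCA rpredD// rpredM.
pose J w := exists u v, [/\ inv u, inv v & w = x * u + y * v].
have inv0 : inv 0 by rewrite /inv !mulr0 rpred0.
have idJ : ideal_of J.
  split=> [_ [u [v [[? _] [_ ?] ->]]]||
    c _ _ Ac [u [v [Iu Iv ->]]] [u' [v' [Iu' Iv' ->]]]].
  - by rewrite rpredD.
  - by exists 0, 0; split=> //; rewrite !mulr0 addr0.
  - exists (c * u + u'), (c * v + v'); split; [exact: invD|exact: invD|ring].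
have Jinv u : inv u -> J (x * u) /\ J (y * u).
  by move=> Iu; split; [exists u, 0|exists 0, u]; split=> //; rewrite mulr0 ?addr0 ?add0r.
have Jx : J x by rewrite -[x]mulr1; apply: (Jinv 1 _).1; rewrite /inv !mulr1.
have [[u [v [[? ?] [? ?] E]]]|J1] := pselect (J 1); first by exists u, v.
have [r [Ar rx rJ]] := quotient_annihilator idJ Jx x0 J1.
suff rn k : x * (r / x) ^+ k \in A /\ y * (r / x) ^+ k \in A.
  suff : r / x \in A by rewrite (negPf rx).
  by apply: (A_cic x0) => k; rewrite mulrC; exact: (rn k).1.
elim: k => [|k /Jinv[Jk Jk']]; first by rewrite !mulr1.
have step w : w * (r / x) ^+ k.+1 = r * (w * (r / x) ^+ k) / x.
  by rewrite exprS; ring.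
by rewrite !step !rJ.
Qed.

Lemma inverse_pair x y : x \in A -> y \in A -> (x != 0) || (y != 0) ->
  exists u v, x * u + y * v = 1 /\
    [/\ x * u \in A, y * u \in A, x * v \in A & y * v \in A].
Proof.
move=> Ax Ay /orP[x0|y0]; first exact: inverse_pair_neq0.
have [u [v [E [? ? ? ?]]]] := inverse_pair_neq0 Ay Ax y0.
by exists v, u; rewrite addrC.
Qed.

(** * The localization at 1 + N is a Bezout ring *)

Section Localization.
Variable N : set F.
Hypotheses (idN : ideal_of N) (N1 : ~ N 1) (N_neq0 : exists2 a, N a & a != 0).

(** The localization of A at the multiplicative set 1 + N, as a subset of F. *)
Definition loc (x : F) : Prop := exists2 d, N (1 - d) & d * x \in A.

Lemma near1_mem d : N (1 - d) -> d \in A.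
Proof. by have [NA _ _] := idN => /NA H; rewrite -[d](subKr 1) rpredB ?rpred1. Qed.

Lemma near1_neq0 d : N (1 - d) -> d != 0.
Proof. by move=> Nd; apply: contra_notN N1 => /eqP d0; rewrite d0 subr0 in Nd. Qed.

Lemma near1M d d' : N (1 - d) -> N (1 - d') -> N (1 - d * d').
Proof.
move=> Nd Nd'; have -> : 1 - d * d' = d * (1 - d') + (1 - d) by ring.
by have [_ _] := idN; apply=> //; exact: near1_mem.
Qed.

Lemma near1_1 : N (1 - 1).
Proof. by rewrite subrr; case: idN. Qed.

Lemma loc_mem x : x \in A -> loc x.
Proof. by exists 1; [exact: near1_1 | rewrite mul1r]. Qed.

Lemma locM x y : loc x -> loc y -> loc (x * y).
Proof.
move=> [d Nd dx] [d' Nd' dy]; exists (d * d'); first exact: near1M.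
by rewrite mulrACA rpredM.
Qed.

Lemma locD x y : loc x -> loc y -> loc (x + y).
Proof.
move=> [d Nd dx] [d' Nd' dy]; exists (d * d'); first exact: near1M.
rewrite mulrDr mulrAC -[d * d' * y]mulrA.
by rewrite rpredD // rpredM // near1_mem.
Qed.

Lemma locN x : loc x -> loc (- x).
Proof. by move=> [d Nd dx]; exists d; rewrite ?mulrN ?rpredN. Qed.

Lemma locB x y : loc x -> loc y -> loc (x - y).
Proof. by move=> lx ly; apply: locD => //; exact: locN. Qed.

Lemma loc0 : loc 0. Proof. by apply: loc_mem; rewrite rpred0. Qed.

Lemma loc_sum (I : Type) (s : seq I) (P : pred I) (f : I -> F) :
  (forall i, P i -> loc (f i)) -> loc (\sum_(i <- s | P i) f i).
Proof. by move=> H; apply: big_ind => //; [exact: loc0|exact: locD]. Qed.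

Lemma near1V d : N (1 - d) -> loc d^-1.
Proof. by move=> Nd; exists d => //; rewrite divff ?rpred1 ?near1_neq0. Qed.

Lemma loc_denominator (I : finType) (f : I -> F) : (forall i, loc (f i)) ->
  exists2 d, N (1 - d) & forall i, d * f i \in A.
Proof.
move=> /(_ _)/cid2 H; pose d i := s2val (H i); exists (\prod_i d i).
  apply: (big_ind (fun d => N (1 - d))) => [||i _]; first exact: near1_1.
    exact: near1M.
  exact: (s2valP (H i)).
move=> i; rewrite (bigD1 i)//= mulrAC; apply: rpredM; first exact: (s2valP' (H i)).
by apply: rpred_prod => j _; apply/near1_mem/(s2valP (H j)).
Qed.

(** N loc meets A in N: elements of 1 + N are units modulo N. *)
Lemma loc_ideal_mem x y : x \in A -> N y -> forall z, loc z -> x = y * z -> N x.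
Proof.
move=> Ax Ny z [d Nd dz] E.
have -> : x = (d * z) * y + x * (1 - d) by rewrite E; ring.
by have [_ _ ND] := idN; apply: ND => //; exact: idealM.
Qed.

(** With x u + y v = 1 for u, v in (x, y)^-1, choose k with e = (x u)^k
    idempotent modulo a nonzero a in N. Then e is a multiple of x u and 1 - e a
    multiple g y v of y v, where g = 1 + x u + ... + (x u)^(k-1). The
    combinations z = e x + (1 - e) y and w = e (x u)^(k-1) u + (1 - e) g v
    satisfy z w = e^3 + (1 - e)^3 = 1 modulo a, as the cross terms contain e (1
    - e). So z w is invertible in the localization, and x = (x w / z w) z with
    x w in A. *)
Lemma bezout_mem x y : x \in A -> y \in A -> exists z a b c d,
  [/\ loc a, loc b, loc c & loc d] /\ [/\ z = a * x + b * y, x = c * z & y = d * z].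
Proof.
move=> Ax Ay; have [|] := boolP ((x != 0) || (y != 0)); last first.
  rewrite negb_or !negbK => /andP[/eqP-> /eqP->].
  by exists 0, 0, 0, 0, 0; rewrite !mulr0 addr0; split; split=> //; exact: loc0.
case/(inverse_pair Ax Ay) => u [v [E [xu yu xv yv]]].
have [a Na a0] := N_neq0; have [NA N0 ND] := idN.
have [k k0 Hk] := idempotent_power (NA _ Na) a0 xu.
pose e := (x * u) ^+ k; pose g := \sum_(i < k) (x * u) ^+ i.
have fE : 1 - e = y * v * g.
  have -> : y * v = 1 - x * u by rewrite -E addrAC subrr add0r.
  by rewrite /e /g -[LHS]opprB subrX1 -[LHS]mulNr opprB.
have eE : e = x * u * (x * u) ^+ k.-1 by rewrite -exprS prednK.
have Ae : e \in A by rewrite rpredX.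
have Ag : g \in A by rewrite rpred_sum// => i _; rewrite rpredX.
pose z := e * x + (1 - e) * y.
pose w := e * (x * u) ^+ k.-1 * u + (1 - e) * g * v.
pose h := x * v * g + y * u * (x * u) ^+ k.-1.
have Nef : N (1 - z * w).
  (* e^3 + (1 - e)^3 = 1 - 3 e (1 - e), and h collects the cross terms. *)
  have -> : 1 - z * w = ((3 - h) * (e * (1 - e) / a)) * a.
    have -> : z * w = e ^+ 2 * (x * u * (x * u) ^+ k.-1)
       + (1 - e) ^+ 2 * (y * v * g) + e * (1 - e) * h by rewrite /z /w /h; ring.
    rewrite -eE -fE; field; exact: a0.
  apply: idealM => //; apply: rpredM => //.
  rewrite rpredB ?rpred_nat// rpredD//; first exact: rpredM.
  by rewrite rpredM// rpredX.
have s0 := near1_neq0 Nef.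
have div t : t * w \in A -> loc (t * w / (z * w)).
  by move=> tw; apply: locM; [exact: loc_mem | exact: near1V].
have [z0 w0] : z != 0 /\ w != 0 by apply/andP; rewrite -negb_or -mulf_eq0.
have Aw t : t * u \in A -> t * v \in A -> t * w \in A.
  move=> tu tv; have -> : t * w = e * (x * u) ^+ k.-1 * (t * u)
     + (1 - e) * g * (t * v) by rewrite /w; ring.
  by rewrite rpredD// rpredM// rpredM// ?rpredX// rpredB ?rpred1.
exists z, e, (1 - e), (x * w / (z * w)), (y * w / (z * w)); split; split=> //.
- exact: loc_mem.
- by apply: loc_mem; rewrite rpredB ?rpred1.
- by apply/div/Aw.
- by apply/div/Aw.
- by field; rewrite z0 w0.
- by field; rewrite z0 w0.
Qed.

Lemma bezout x y : loc x -> loc y -> exists z a b c d,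
  [/\ loc a, loc b, loc c & loc d] /\ [/\ z = a * x + b * y, x = c * z & y = d * z].
Proof.
move=> [s Ns sx] [t Nt ty].
have [z [a [b [c [d [[la lb lc ld] [zE xE yE]]]]]]] := bezout_mem sx ty.
have s0 := near1_neq0 Ns; have t0 := near1_neq0 Nt.
exists z, (a * s), (b * t), (s^-1 * c), (t^-1 * d); split; split.
- by apply: locM => //; exact/loc_mem/near1_mem.
- by apply: locM => //; exact/loc_mem/near1_mem.
- by apply: locM => //; exact: near1V.
- by apply: locM => //; exact: near1V.
- by rewrite zE; ring.
- by rewrite -mulrA -xE mulKf.
- by rewrite -mulrA -yE mulKf.
Qed.

Definition mx_loc m n (M : 'M[F]_(m, n)) := forall i j, loc (M i j).

Lemma mx_locM m n p (M : 'M_(m, n)) (M' : 'M_(n, p)) :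
  mx_loc M -> mx_loc M' -> mx_loc (M *m M').
Proof. by move=> lM lM' i j; rewrite mxE; apply: loc_sum => k _; exact: locM. Qed.

Lemma mx_locB m n (M M' : 'M_(m, n)) : mx_loc M -> mx_loc M' -> mx_loc (M - M').
Proof. by move=> lM lM' i j; rewrite !mxE; exact: locB. Qed.

Lemma mx_loc_scalar n z : loc z -> mx_loc (z%:M : 'M_n).
Proof. by move=> lz i j; rewrite mxE; case: eqP => _ //; exact: loc0. Qed.

Lemma mx_loc_col m1 m2 n (M : 'M_(m1, n)) (M' : 'M_(m2, n)) :
  mx_loc M -> mx_loc M' -> mx_loc (col_mx M M').
Proof.
by move=> lM lM' i j; rewrite mxE; case: (fintype.split i).
Qed.

Lemma mx_loc_row m n1 n2 (M : 'M_(m, n1)) (M' : 'M_(m, n2)) :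
  mx_loc M -> mx_loc M' -> mx_loc (row_mx M M').
Proof.
by move=> lM lM' i j; rewrite mxE; case: (fintype.split j).
Qed.

Lemma bezout_col n (c : 'cV_n) : mx_loc c ->
  exists z (a : 'rV_n) (g : 'cV_n),
    [/\ mx_loc a, mx_loc g, a *m c = z%:M & c = g *m z%:M].
Proof.
elim: n c => [|n IH] c lc.
  exists 0, 0, 0; split; [by move=> ? []|by move=> []| |by apply/matrixP => [[]]].
  by rewrite mul0mx raddf0.
rewrite -[n.+1]/(1 + n)%N in c lc *.
have [|z' [a' [g' [la' lg' E1 E2]]]] := IH (dsubmx c).
  by move=> i j; rewrite mxE; exact: lc.
have lz' : loc z'.
  have /matrixP/(_ 0 0) := E1; rewrite [RHS]mxE eqxx mulr1n => <-.
  by apply: mx_locM => // i j; rewrite mxE; exact: lc.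
have lc0 : loc (usubmx c 0 0) by rewrite mxE; exact: lc.
have [z [a [b [g [d [[la lb lg ld] [zE cE z'E]]]]]]] := bezout lc0 lz'.
exists z, (row_mx a%:M (b%:M *m a')), (col_mx g%:M (g' *m d%:M)).
have cE' : usubmx c = (usubmx c 0 0)%:M by rewrite -mx11_scalar.
split.
- by apply: mx_loc_row; [exact: mx_loc_scalar|apply: mx_locM => //; exact: mx_loc_scalar].
- by apply: mx_loc_col; [exact: mx_loc_scalar|apply: mx_locM => //; exact: mx_loc_scalar].
- rewrite -{1}[c]vsubmxK mul_row_col -mulmxA E1 cE' -!scalar_mxM -raddfD /=.
  by rewrite -zE.
- rewrite -{1}[c]vsubmxK mul_col_mx -mulmxA -!scalar_mxM -cE -z'E -E2.
  by rewrite -cE'.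
Qed.

(** Reduction to echelon form over a ring where finitely generated ideals are
    principal. If z generates the ideal of the entries of the first column of G
    = (c | G'), with c = g z and a c = z, then subtracting g times the row a G
    from G clears the first column, and the induction applies to the rest; the
    row (z | a G') completes the basis. *)
Lemma hermite_form s n (G : 'M_(n, s)) : mx_loc G ->
  exists k (H : 'M_(k, s)) (X : 'M_(n, k)) (Y : 'M_(k, n)),
    [/\ mx_loc X, mx_loc Y, G = X *m H, H = Y *m G & row_free H].
Proof.
elim: s G => [|s IH] G lG.
  exists 0, 0, 0, 0; split; [by move=> ? []|by move=> []| | |].
  - by apply/matrixP => i [].
  - by apply/matrixP => [[]].
  - by rewrite /row_free mxrank0.
rewrite -[s.+1]/(1 + s)%N in G lG *.
have [|z [a [g [la lg E1 E2]]]] := @bezout_col n (lsubmx G).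
  by move=> i j; rewrite mxE; exact: lG.
have lr : mx_loc (rsubmx G) by move=> i j; rewrite mxE; exact: lG.
have GE : row_mx (lsubmx G) (rsubmx G) = G by rewrite hsubmxK.
have [z0|z0] := eqVneq z 0.
  have [k [H [X [Y [lX lY GX HY Hfree]]]]] := IH _ lr.
  have l0 : lsubmx G = 0 by rewrite E2 z0 raddf0 mulmx0.
  exists k, (row_mx 0 H), X, Y; split=> //.
  - by rewrite mul_mx_row mulmx0 -GX -l0.
  - by rewrite -{1}GE mul_mx_row -HY l0 mulmx0.
  - apply: inj_row_free => v; rewrite mul_mx_row mulmx0 => /eqP.
    rewrite row_mx_eq0 eqxx /= mulmx_free_eq0 // => /eqP //.
have [|k [H [X [Y [lX lY GX HY Hfree]]]]] := IH (rsubmx G - g *m (a *m rsubmx G)).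
  by apply: mx_locB => //; do 2!apply: mx_locM => //.
exists (1 + k)%N, (block_mx z%:M (a *m rsubmx G) 0 H), (row_mx g X),
  (col_mx a (Y - Y *m g *m a)); split.
- exact: mx_loc_row.
- by apply: mx_loc_col => //; apply: mx_locB => //; do 2!apply: mx_locM => //.
- rewrite mul_row_block mulmx0 addr0 -E2 -GX addrC subrK.
  by rewrite hsubmxK.
- rewrite -[G in RHS]GE mul_col_mx !mul_mx_row E1 !mulmxBl -!mulmxA E1 -E2 subrr.
  by rewrite -mulmxBr -HY /block_mx.
- apply: inj_row_free => v; rewrite -[v]hsubmxK mul_row_block mulmx0 addr0 => /eqP.
  rewrite row_mx_eq0 => /andP[]; rewrite mul_mx_scalar scalemx_eq0 (negPf z0) /=.
  move=> /eqP->; rewrite mul0mx add0r mulmx_free_eq0 // => /eqP->.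
  by rewrite row_mx0.
Qed.

End Localization.
End Dedekind.

Section NearGenerator.
Variables (F : fieldType) (A : subringClosed F).
Hypothesis A_cic : completely_integrally_closed A.
Hypothesis A_fin : finite_quotients A.
Variable N : set F.
Hypotheses (idN : ideal_of A N) (N1 : ~ N 1) (N_neq0 : exists2 a, N a & a != 0).

(** Locally at N the ideal N has a generator z; multiplying z by an element of
    1 + N puts it in N itself, and multiplying 1/z by another one puts it in
    N^-1, as only the finitely many coefficients of a generating column matter.
    So N N^-1 = A is witnessed, up to 1 + N, by the single product z w. *)
Lemma ideal_near_generator : exists z w,
  [/\ N z, forall x, N x -> x * w \in A & N (1 - z * w)].
Proof.
have [a Na a0] := N_neq0; have [NA N0 ND] := idN.
have [s [sN s_rep]] := ideal_fg A_fin idN Na a0.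
pose c : 'cV[F]_(size s).+1 := \col_i (a :: s)`_i.
have cN i : N (c i 0).
  by rewrite mxE; have := mem_nth 0 (ltn_ord i : (i < size (a :: s))%N);
     rewrite inE => /predU1P[->|/sN].
have c_gen x : N x -> exists2 m : 'rV_(size s).+1,
    (forall j, m 0 j \in A) & x = (m *m c) 0 0.
  move=> /s_rep[y ys xy].
  have iy : (index y (a :: s) < (size s).+1)%N.
    by rewrite index_mem inE ys orbT.
  exists (delta_mx 0 (Ordinal iy) + ((x - y) / a) *: delta_mx 0 ord0).
    move=> j; rewrite !mxE !eqxx /=; apply: rpredD; first exact: rpred_nat.
    by rewrite rpredM// rpred_nat.
  rewrite mulmxDl -scalemxAl -!rowE !mxE /= nth_index ?inE ?ys ?orbT//.
  by rewrite divfK// addrC subrK.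
have [|z [al [ga [lal lga E1 E2]]]] := @bezout_col _ A A_cic A_fin N idN N1 N_neq0 _ c.
  by move=> i j; rewrite ord1; apply/(loc_mem idN)/NA/cN.
have [d Nd dal] := loc_denominator idN (fun i => lal 0 i).
have [d' Nd' dga] := loc_denominator idN (fun i => lga i 0).
have zE : z = \sum_j al 0 j * c j 0.
  by have /matrixP/(_ 0 0) := E1; rewrite !mxE eqxx mulr1n.
have z0 : z != 0.
  apply: contra_neq a0 => z0; have := E2; rewrite z0 raddf0 mulmx0.
  by move/matrixP/(_ 0 0); rewrite !mxE.
exists (d * z), (d' / z); split.
- rewrite zE mulr_sumr; apply: (big_ind N) => [||j _] //.
    by move=> x y; exact: (idealD idN).
  by rewrite mulrA; exact: (idealM idN).
- move=> x /c_gen[m Am ->]; rewrite E2 mulmxA !mxE.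
  rewrite big_ord1 !mxE eqxx mulr1n [d' / z]mulrC mulrA mulfK//.
  rewrite mulr_suml rpred_sum// => j _.
  by rewrite -mulrA rpredM// mulrC.
- have -> : d * z * (d' / z) = d * d' by field.
  exact: (near1M idN).
Qed.

End NearGenerator.

(** * The ring of regular functions *)

Section FractionNumden.
Local Open Scope quotient_scope.
Lemma fraction_numden (R : idomainType) (x : {fraction R}) :
  exists n d : R, d != 0 /\ x * (@tofrac R d) = @tofrac R n.
Proof.
elim/quotW: x => x; exists \n_x, \d_x; split; first exact: denom_ratioP.
rewrite -[LHS]/(FracField.mul _ _) !piE; apply/eqP; rewrite eqquotE.
rewrite /FracField.equivf /FracField.mulf.
by rewrite !numden_Ratio ?mulf_neq0 ?oner_neq0 ?denom_ratioP // !mulr1 mulrC.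
Qed.
End FractionNumden.

Section Arithmetic.
Variables (F : fieldType) (inf : place F).
Local Notation A := (regular_ring inf).

(** If v(u) < 0 then v(u^k g) = k v(u) + v(g) tends to minus infinity with k;
    the exponent |v(g)| + 1 already makes it negative. *)
Lemma regular_completely_integrally_closed :
  completely_integrally_closed (regular inf).
Proof.
move=> u g g0 H; have [->|u0] := eqVneq u 0; first exact: rpred0.
apply/asboolP => v vinf; right; rewrite leNgt; apply/negP => vu.
have vX k : v (u ^+ k) = v u *+ k.
  elim: k => [|k IH]; first by rewrite expr0 pord1.
  by rewrite exprS pordM ?expf_neq0// IH mulrS.
have /asboolP/(_ v vinf) := H `|v g|.+1.
have /negPf nz : u ^+ `|v g|.+1 * g != 0 by rewrite mulf_neq0 ?expf_neq0.
case=> [/eqP|]; rewrite ?nz// pordM ?expf_neq0// vX.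
rewrite leNgt => /negP; apply.
have : v u *+ `|v g|.+1 <= -1 *+ `|v g|.+1 by rewrite lerMn2r; lia.
by rewrite mulrS; lia.
Qed.

Lemma regular_finite_quotient :
  global_function_field F -> finite_quotients (regular inf).
Proof.
move=> hF.
have [p _ [f [n [b b_span]]]] := hF.
pose e : {rmorphism {poly 'F_p} -> F} := f \o (@tofrac {poly 'F_p}).
have e_inj : injective e by move=> x y /fmorph_inj/eqP; rewrite tofrac_eq => /eqP.
apply: (finite_quotient (e := e) e_inj (b := b)) => x.
have [c ->] := b_span x.
have /choice[num /choice[den H]] i := fraction_numden (c i).
exists (\prod_i den i), (fun i => num i * \prod_(j | j != i) den j); split.
  by apply/prodf_neq0 => i _; exact: (H i).1.
rewrite mulr_sumr; apply: eq_bigr => i _; rewrite mulrA; congr (_ * _).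
by rewrite (bigD1 i)//= !rmorphM /= -(H i).2 !rmorphM /=; ring.
Qed.

(** * Lattices localized at N *)

Section Lattice.
Variables (R : realType) (C : fieldType) (aC : absval R C) (iota : {rmorphism F -> C}).
Local Notation CA := (CA inf iota).
Local Notation "M ^i" := (map_mx iota M) (at level 2, format "M ^i").

Definition val_mx m n (M : 'M[A]_(m, n)) : 'M[F]_(m, n) := map_mx val M.

Lemma CA_scaleE (a : A) (x : CA) : a *: x = iota (val a) * x :> C.
Proof. by []. Qed.

Lemma submodule_sum (L : set CA) n (a : 'I_n -> A) (x : 'I_n -> CA) :
  is_submodule L -> (forall i, L (x i)) -> L (\sum_i a i *: x i).
Proof.
move=> [L0 LD] Lx; apply: (big_ind L) => // [u v Lu Lv|i _].
  by rewrite -[u]scale1r; exact: LD.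
by rewrite -[_ *: _]addr0; exact: LD.
Qed.

Lemma common_denominator n s (b : 'I_s -> CA) (x : 'I_n -> CA) :
  (forall i, exists (d : A) (a : 'I_s -> A), d != 0 /\ d *: x i = \sum_j a j *: b j) ->
  exists (d : A) (P : 'M[A]_(n, s)), d != 0 /\
    iota (val d) *: (\col_i x i : 'cV[C]_n) = (val_mx P)^i *m (\col_i b i : 'cV[C]_s).
Proof.
move=> /choice[d /choice[a H]].
have vprod (I : finType) (Q : pred I) (f : I -> A) :
    val (\prod_(i | Q i) f i) = \prod_(i | Q i) val (f i) := rmorph_prod _ _ _ _.
exists (\prod_i d i), (\matrix_(i, j) (\prod_(k | k != i) d k * a i j)); split.
  rewrite -(inj_eq val_inj) vprod; apply/prodf_neq0 => i _.
  by rewrite (inj_eq val_inj (d i) 0); exact: (H i).1.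
apply/matrixP => i j; rewrite ord1 !mxE (bigD1 i)//.
have -> : val (d i * \prod_(k | k != i) d k)
   = val (\prod_(k | k != i) d k) * val (d i) by rewrite mulrC.
rewrite rmorphM -mulrA.
have -> : iota (val (d i)) * x i = \sum_j iota (val (a i j)) * b j := (H i).2.
by rewrite mulr_sumr; apply: eq_bigr => k _; rewrite !mxE mulrA -rmorphM.
Qed.

(** Independence against coefficients in a subset S of F: it is wanted for A,
    where it is part of the definition of the rank, and for its localization.
    *)
Definition independent_over (S : set F) s (b : 'cV[C]_s) :=
  forall v : 'rV[F]_s, (forall i, S (v 0 i)) -> v^i *m b = 0 -> v = 0.

Lemma independent_regular s (b : 'I_s -> CA) :
  (forall a : 'I_s -> A, \sum_i a i *: b i = 0 -> forall i, a i = 0) ->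
  independent_over [set` regular inf] (\col_i b i).
Proof.
move=> H v Av E; apply/matrixP => i j; rewrite ord1 mxE.
have sum0 : \sum_i RegularRing (Av i) *: b i = 0 :> CA.
  have /matrixP/(_ 0 0) := E; rewrite !mxE => E0; rewrite -[RHS]E0.
  by apply: eq_bigr => k _; rewrite !mxE.
exact: (congr1 val (H _ sum0 j)).
Qed.

Lemma independent_mx S m s (b : 'cV[C]_s) (M M' : 'M[F]_(m, s)) :
  independent_over S b -> (forall i j, S (M i j - M' i j)) ->
  M^i *m b = M'^i *m b -> M = M'.
Proof.
move=> indb SM E; apply/eqP; rewrite -subr_eq0; apply/eqP/row_matrixP => i.
rewrite row0; apply: indb => [j|]; first by rewrite !mxE; exact: SM.
by rewrite map_row -row_mul map_mxB mulmxBl E subrr row0.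
Qed.

(** Two maximal independent families give matrices P and P' over A whose
    product is a nonzero scalar matrix of size s and factors through dimension
    t. *)
Lemma has_rank_le (U : set CA) s t : has_rank U s -> has_rank U t -> (s <= t)%N.
Proof.
move=> [b [Ub ib bU]] [b' [Ub' _ b'U]].
have [d [P [d0 PE]]] := common_denominator (fun i => bU _ (Ub' i)).
have [d' [P' [d'0 P'E]]] := common_denominator (fun i => b'U _ (Ub i)).
have PPE : val_mx P' *m val_mx P = (val d' * val d)%:M.
  apply: (independent_mx (independent_regular ib)) => [i j|].
    rewrite /= rpredB//; last by rewrite mxE rpredMn// rpredM//; exact: valP.
    by rewrite mxE rpred_sum// => k _; rewrite !mxE rpredM//; exact: valP.
  rewrite map_mxM -mulmxA -PE -scalemxAr -P'E scalerA map_scalar_mx mul_scalar_mx.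
  by rewrite rmorphM mulrC.
have dd0 : val d' * val d != 0 by rewrite mulf_neq0// (inj_eq val_inj _ 0).
have := mxrankM_maxr (val_mx P') (val_mx P).
rewrite PPE -scalemx1 mxrank_scale_nz// mxrank1 => /leq_trans; apply.
exact: rank_leq_row.
Qed.

Variable N : idealr A.
Hypothesis (hF : global_function_field F) (hN : exists2 a, a \in N & a != 0).

(** The ideal N as a subset of F. *)
Definition val_ideal : set F := [set x | exists2 a : A, a \in N & val a = x].

Lemma val_idealE (a : A) : val_ideal (val a) <-> a \in N.
Proof. by split=> [[b Nb /val_inj <-]//|Na]; exists a. Qed.

Lemma val_ideal_ideal : ideal_of (regular inf) val_ideal.
Proof.
split=> [_ [a _ <-]||c _ _ Ac [a Na <-] [b Nb <-]]; first exact: valP.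
  by exists 0; rewrite ?rpred0.
by exists (RegularRing Ac * a + b); rewrite ?rpredD ?idealMr.
Qed.

Lemma val_ideal_proper : ~ val_ideal 1.
Proof. by move=> [a Na] /(@val_inj _ _ A a 1) a1; move: Na; rewrite a1 idealr1. Qed.

Lemma val_ideal_neq0 : exists2 a, val_ideal a & a != 0.
Proof.
have [a Na a0] := hN; exists (val a); first by exists a.
by rewrite (inj_eq val_inj _ 0).
Qed.

Local Notation loc := (loc (regular inf) val_ideal).
Local Notation mx_loc := (mx_loc (regular inf) val_ideal).
Local Notation idN := val_ideal_ideal.

Lemma independent_loc s (b : 'cV[C]_s) :
  independent_over [set` regular inf] b -> independent_over loc b.
Proof.
move=> indb v lv E.
have [d Nd dv] := loc_denominator idN lv.
have d0 := near1_neq0 val_ideal_proper Nd.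
suff : d *: v = 0 by move/eqP; rewrite scalemx_eq0 (negPf d0) => /eqP.
apply: indb => [i|]; first by rewrite mxE; exact: dv.
by rewrite map_mxZ -scalemxAl E scaler0.
Qed.

(** In coordinates with respect to a maximal independent family of L, the
    generators g form a matrix P over A up to a common denominator d, and its
    Hermite form provides the localized basis b. The number of rows of the form
    is s because P has a left inverse up to a scalar, the maximal independent
    family being itself in L. *)
Lemma lattice_local_basis (L : lattice inf aC iota) s : has_rank L s ->
  exists n (g : 'I_n -> CA) (b : 'cV[C]_s) (X : 'M[F]_(n, s)) (Y : 'M[F]_(s, n)),
  [/\ forall i, lattice_set L (g i),
      forall x : CA, lattice_set L x -> exists a : 'I_n -> A, x = \sum_i a i *: g i,
      independent_over loc b,
      mx_loc X /\ mx_loc Y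
    & (\col_i g i : 'cV[C]_n) = X^i *m b /\ b = Y^i *m (\col_i g i : 'cV[C]_n)].
Proof.
move=> [b0 [Lb0 ib0 b0L]]; have [n [g [Lg gL]]] := lattice_fg L.
have [d [P [d0 PE]]] := common_denominator (fun i => b0L _ (Lg i)).
have /choice[q Hq] i := gL _ (Lb0 i).
pose Q := \matrix_(i, j) val (q i j).
have QE : (\col_i b0 i : 'cV[C]_s) = Q^i *m (\col_i g i : 'cV[C]_n).
  apply/matrixP => i j; rewrite !mxE Hq.
  by apply: eq_bigr => k _; rewrite !mxE.
have vd0 : val d != 0 by rewrite (inj_eq val_inj _ 0).
have QP : Q *m val_mx P = (val d)%:M.
  apply: (independent_mx (independent_regular ib0)) => [i j|].
    rewrite /= rpredB//; last by rewrite mxE rpredMn//; exact: valP.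
    by rewrite mxE rpred_sum// => k _; rewrite !mxE rpredM//; exact: valP.
  by rewrite map_mxM -mulmxA -PE -scalemxAr -QE map_scalar_mx mul_scalar_mx.
have [|k [H [X [Y [lX lY PH HP Hfree]]]]] := @hermite_form _ (regular inf)
  regular_completely_integrally_closed (regular_finite_quotient hF)
  _ idN val_ideal_proper val_ideal_neq0 _ _ (val_mx P).
  by move=> i j; apply: (loc_mem idN); rewrite mxE; exact: valP.
have sk : s = k.
  apply/eqP; rewrite eqn_leq; apply/andP; split.
    have := mxrankM_maxr Q (val_mx P); rewrite QP -scalemx1 mxrank_scale_nz// mxrank1.
    move=> /leq_trans; apply; rewrite PH; apply: leq_trans (mxrankM_maxr _ _) _.
    exact: rank_leq_row.
  by rewrite -(eqP Hfree) rank_leq_col.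
subst k; exists n, g, ((iota (val d))^-1 *: (H^i *m (\col_i b0 i))), X, Y.
have id0 : iota (val d) != 0 by rewrite fmorph_eq0.
split=> //.
- move=> v lv; rewrite -scalemxAr => /eqP.
  rewrite scalemx_eq0 invr_eq0 (negPf id0) mulmxA -map_mxM => /eqP vH0.
  have lH : mx_loc H.
    rewrite HP; apply: (mx_locM idN) => // i j.
    by apply: (loc_mem idN); rewrite mxE; exact: valP.
  have lv' : mx_loc v by move=> i j; rewrite ord1.
  have /eqP := independent_loc (independent_regular ib0)
    (fun j => mx_locM idN lv' lH 0 j) vH0.
  by rewrite mulmx_free_eq0// => /eqP.
- split.
    rewrite -scalemxAr mulmxA -map_mxM -PH.
    by rewrite -PE scalerA mulVf// scale1r.
  rewrite HP map_mxM -mulmxA -PE -scalemxAr scalerA mulVf// scale1r //.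
Qed.

(** The basis is e_l = w d b_l, where b is a basis of L over the localization,
    z w is in 1 + N with z in N and w in N^-1, and d in 1 + N moves every b_l
    into L. An element of N^-1 L has coordinates in the localization since z
    N^-1 is in A; multiplying by some d' in 1 + N puts them in A, and changes
    the element by an element of N N^-1 L, hence of L. Conversely, if the sum
    of the a_l e_l is in L, then a_l w is in the localization, so a_l is in the
    ideal that z generates there, which meets A in N. *)
Lemma torsion_basis (L : lattice inf aC iota) s : has_rank L s ->
  exists e : 'I_s -> CA,
  [/\ forall l, inv_ideal_mul N L (e l),
      forall x, inv_ideal_mul N L x ->
        exists a : 'I_s -> A, lattice_set L (x - \sum_l a l *: e l)
    & forall a : 'I_s -> A, lattice_set L (\sum_l a l *: e l) -> forall l, a l \in N].
Proof.
move=> Ls.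
have [n [g [b [X [Y [Lg gL indb [lX lY] [gE bE]]]]]]] := lattice_local_basis Ls.
have [z [w [Nz wN Nzw]]] := ideal_near_generator
  regular_completely_integrally_closed (regular_finite_quotient hF)
  idN val_ideal_proper val_ideal_neq0.
have [zw0 L0] : z * w != 0 /\ lattice_set L 0.
  by split; [exact: (near1_neq0 val_ideal_proper Nzw)|case: (lattice_submodule L)].
have [z0 w0] : z != 0 /\ w != 0 by apply/andP; rewrite -negb_or -mulf_eq0.
have [d Nd dY] := loc_denominator idN (fun ij => lY ij.1 ij.2).
have d0 := near1_neq0 val_ideal_proper Nd.
have invw : inv_ideal N w.
  by move=> a /val_idealE/wN.
exists (fun l => iota w * (iota d * b l 0)); split.
- move=> l; exists 1%N, (fun=> w), (fun=> iota d * b l 0); split=> [//|_|].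
    have -> : iota d * b l 0 = \sum_j RegularRing (dY (l, j)) *: g j :> CA.
      rewrite bE !mxE mulr_sumr; apply: eq_bigr => j _.
      by rewrite CA_scaleE /= !mxE mulrA rmorphM.
    by apply: submodule_sum Lg; exact: lattice_submodule.
  by rewrite big_ord1.
- move=> x Lx.
  have [c [lc xE]] : exists c : 'rV[F]_s, mx_loc c /\
      x = \sum_l iota (c 0 l) * (iota w * (iota d * b l 0)).
    have [m [y [h [Ny Lh ->]]]] := Lx.
    have /choice[a Ha] i := gL _ (Lh i).
    exists (\sum_i \row_l (\sum_j y i / (w * d) * val (a i j) * X j l)); split.
      move=> i0 l; rewrite ord1 summxE; apply: (loc_sum idN) => i _.
      rewrite mxE; apply: (loc_sum idN) => j _.
      have -> : y i / (w * d) * val (a i j) * X j l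
        = (z * y i) * (val (a i j)) * (z * w)^-1 * d^-1 * X j l.
        by field; rewrite w0 z0 d0.
      apply: (locM idN) => //; apply: (locM idN); last exact: (near1V _ val_ideal_proper).
      apply: (locM idN); last exact: (near1V _ val_ideal_proper).
      apply: (loc_mem idN); rewrite rpredM//; last exact: valP.
      by have [z' Nz' <-] := Nz; exact: Ny.
    rewrite (eq_bigr (fun l => \sum_i \sum_j
      iota (y i) * iota (val (a i j)) * (iota (X j l) * b l 0))).
      rewrite exchange_big /=; apply: eq_bigr => i _; rewrite Ha mulr_sumr.
      rewrite exchange_big /=; apply: eq_bigr => j _; rewrite CA_scaleE.
      have /matrixP/(_ j 0) := gE; rewrite !mxE => ->.
      by rewrite mulrA mulr_sumr; apply: eq_bigr => l _; rewrite !mxE.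
    move=> l _; rewrite summxE rmorph_sum mulr_suml; apply: eq_bigr => i _.
    rewrite mxE rmorph_sum mulr_suml; apply: eq_bigr => j _.
    rewrite !rmorphM fmorphV rmorphM; field.
    by rewrite !fmorph_eq0 w0 d0.
  have [d' Nd' dc] := loc_denominator idN (fun l => lc 0 l).
  exists (fun l => RegularRing (dc l)).
  have [d1 Nd1 d1E] := Nd'.
  have -> : x - \sum_l RegularRing (dc l) *: (iota w * (iota d * b l 0) : CA)
      = d1 *: (x : CA).
    rewrite CA_scaleE d1E rmorphB rmorph1 mulrBl mul1r; congr (_ - _).
    rewrite [in RHS]xE mulr_sumr; apply: eq_bigr => l _.
    by rewrite CA_scaleE /= rmorphM -mulrA.
  exact: (inv_ideal_mul_kill Nd1 Lx).
- move=> a La l.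
  have [m mE] := gL _ La.
  pose u : 'rV[F]_s := \row_l (z * w * d * val (a l)).
  pose v : 'rV[F]_s := z *: ((\row_j val (m j)) *m X).
  have Az : z \in regular inf by have [z' _ <-] := Nz; exact: valP.
  have lrow : mx_loc (\row_j val (m j)).
    by move=> i j; rewrite mxE; apply: (loc_mem idN); exact: valP.
  have lv l' : loc (v 0 l').
    rewrite mxE; apply: (locM idN); first exact: (loc_mem idN).
    exact: (mx_locM idN lrow lX).
  (* The factor z makes both sides have coefficients in the localization, where
     b is independent. *)
  have uv : u = v.
    apply: (independent_mx indb) => [i j|].
      rewrite ord1; apply: (locB idN); last exact: lv.
      apply: (loc_mem idN); rewrite mxE rpredM//; last exact: valP.
      by rewrite rpredM//; [exact: (near1_mem idN Nzw)|exact: (near1_mem idN Nd)].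
    rewrite map_mxZ map_mxM -scalemxAl -mulmxA -gE.
    apply/matrixP => i j; rewrite !ord1 [RHS]mxE.
    have -> : ((\row_j val (m j))^i *m (\col_i g i : 'cV[C]_n)) 0 0
        = \sum_i m i *: g i.
      by rewrite mxE; apply: eq_bigr => k _; rewrite !mxE.
    rewrite -mE !mxE mulr_sumr; apply: eq_bigr => k _.
    by rewrite !mxE CA_scaleE !rmorphM; ring.
  have al : w * d * val (a l) = ((\row_j val (m j)) *m X) 0 l.
    apply: (mulfI z0); have /matrixP/(_ 0 l) := uv.
    by rewrite !mxE => <-; rewrite !mulrA.
  apply/val_idealE; apply: (loc_ideal_mem idN _ Nz
      (z := (z * w)^-1 * d^-1 * ((\row_j val (m j)) *m X) 0 l)).
  - exact: valP.
  - apply: (locM idN); last exact: (mx_locM idN lrow lX).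
    by apply: (locM idN); exact: (near1V _ val_ideal_proper).
  - by rewrite -al; field; rewrite w0 z0 d0.
Qed.

End Lattice.

End Arithmetic.

(** * Freeness of the torsion module *)

Section SubquotientClass.
Local Open Scope quotient_scope.
Variables (A : comNzRingType) (N : idealr A) (V : lmodType A) (D : subquotient N V).

Lemma sq_class_surj (m : sqmod D) : exists (x : V) (Px : sq_top D x),
  m = sq_class (SqTop (asboolT Px)).
Proof.
rewrite -[m]sq_class_repr; case: (repr _) => x Px.
exists x, (asboolW Px); congr (sq_class (SqTop _)); exact: bool_irrelevance.
Qed.

Lemma sq_class_sum n (e : 'I_n -> sq_topmod D) (a : 'I_n -> A) :
  \sum_i (\pi_{ideal_quot N} (a i) : {ideal_quot N}) *: (sq_class (e i) : sqmod D)
  = sq_class (\sum_i a i *: e i).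
Proof.
have sc0 : sq_class (0 : sq_topmod D) = 0 :> sqmod D.
  by apply: (addrI (sq_class (0 : sq_topmod D))); rewrite -sq_classD !addr0.
rewrite (big_morph (@sq_class _ _ _ D) (@sq_classD _ _ _ D) sc0).
by apply: eq_bigr => i _; exact: sq_scaleE.
Qed.

End SubquotientClass.

Section Torsion.
Local Open Scope quotient_scope.
Variables (F : fieldType) (inf : place F).
Variables (R : realType) (C : fieldType) (aC : absval R C) (iota : {rmorphism F -> C}).
Variable N : idealr (regular_ring inf).
Hypothesis (hF : global_function_field F) (hN : exists2 a, a \in N & a != 0).

Lemma lattice_torsion_free (L : lattice inf aC iota) s : has_rank L s ->
  exists m : 'I_s -> lattice_torsion N L, forall x : lattice_torsion N L,
    exists! a : {ffun 'I_s -> {ideal_quot N}}, x = \sum_i a i *: m i.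
Proof.
move=> Ls; have [e [Te e_span e_free]] := torsion_basis hF hN Ls.
pose D := lattice_subquotient N L.
pose E i : sq_topmod D := SqTop (asboolT (Te i : sq_top D (e i))).
have valE (a : 'I_s -> regular_ring inf) :
    val (\sum_i a i *: E i) = \sum_i a i *: e i.
  rewrite raddf_sum; apply: eq_bigr => i _.
  exact: (linearZ_LR (val : {linear sq_topmod D -> CA inf iota})).
exists (fun i => sq_class (E i) : lattice_torsion N L) => x.
have [y [Ty xE]] := sq_class_surj x.
have [a Ha] := e_span y Ty.
exists [ffun i => \pi_{ideal_quot N} (a i)]; split.
  rewrite (eq_bigr (fun i => (\pi_{ideal_quot N} (a i) : {ideal_quot N})
     *: (sq_class (E i) : sqmod D))) => [|i _]; last by rewrite ffunE.
  by rewrite (sq_class_sum E) xE; apply/sq_classP; rewrite valE.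
move=> b xb; apply/ffunP => i; rewrite ffunE.
rewrite -[b i]reprK; apply/eqP; rewrite eqquotE /Quotient.equiv.
apply: (e_free (fun i => a i - repr (b i))).
have bE : x = sq_class (\sum_i repr (b i) *: E i).
  rewrite -sq_class_sum [LHS]xb; apply: eq_bigr => j _.
  by rewrite reprK.
have : sq_bot D (val (\sum_i a i *: E i) - val (\sum_i repr (b i) *: E i)).
  apply/sq_classP; rewrite -bE xE; apply/sq_classP; rewrite valE.
  have [L0 LD] := lattice_submodule L.
  have := LD (-1) _ _ Ha L0; rewrite addr0 scaleN1r opprB; exact.
rewrite !valE -sumrB; congr (lattice_set L _).
by apply: eq_bigr => j _; rewrite scalerBl.
Qed.

End Torsion.

(** * The strata *)

Section Bijection.
Variables (F : fieldType) (inf : place F).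
Variables (R : realType) (C : fieldType) (aC : absval R C) (iota : {rmorphism F -> C}).
Variable N : idealr (regular_ring inf).

Lemma level_lattice_ext (L : lattice inf aC iota) s
    (r1 r2 : has_rank L s)
    (f1 f2 : std_torsion_pow N s -> lattice_torsion N L)
    (l1 : linear f1) (l2 : linear f2) (b1 : bijective f1) (b2 : bijective f2) :
  f1 =1 f2 -> LevelLattice r1 l1 b1 = LevelLattice r2 l2 b2.
Proof.
move=> /funext E; subst f2.
by rewrite (Prop_irrelevance r1 r2) (Prop_irrelevance l1 l2) (Prop_irrelevance b1 b2).
Qed.

Lemma inj_lattice_ext (L : lattice inf aC iota) r
    (r1 r2 : exists2 s : nat, (s <= r)%N & has_rank L s)
    (f1 f2 : lattice_torsion N L -> std_torsion_pow N r)
    (l1 : linear f1) (l2 : linear f2) (b1 : injective f1) (b2 : injective f2) :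
  f1 =1 f2 -> InjLattice r1 l1 b1 = InjLattice r2 l2 b2.
Proof.
move=> /funext E; subst f2.
by rewrite (Prop_irrelevance r1 r2) (Prop_irrelevance l1 l2) (Prop_irrelevance b1 b2).
Qed.

(** Equality of pairs (L, iota) in a form that can be used after identifying
    the two lattices, since the types of the two maps depend on them. *)
Lemma inj_lattice_eq r (y1 y2 : inj_lattice N aC iota r) : y1 = y2 ->
  exists E : il_lattice y1 = il_lattice y2, forall m,
    il_map (i := y2) m = il_map (i := y1)
      (eq_rect_r (fun L : lattice inf aC iota => lattice_torsion N L) m E).
Proof. by move=> ->; exists erefl. Qed.

Variables (r : nat) (delta : injective_selection N r).

Lemma strata_map_inj :
  injective (strata_map delta : strata N aC iota r -> inj_lattice N aC iota r).
Proof.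
move=> [[s1 U1] X1] [[s2 U2] X2] /inj_lattice_eq[] /=.
case: X1 => L1 r1 f1 l1 b1; case: X2 => L2 r2 f2 l2 b2 /= E.
subst L2; rewrite /eq_rect_r /= => E.
have s12 : s1 = s2.
  by apply/val_inj/eqP; rewrite eqn_leq (has_rank_le r1 r2) (has_rank_le r2 r1).
subst s2.
have U12 : U1 = U2.
  suff : sval U1 = sval U2.
    case: (U1) (U2) => [u1 p1] [u2 p2] /= u12; subst u2.
    by rewrite (Prop_irrelevance p1 p2).
  rewrite -!(selection_image delta); apply/seteqP.
  split=> _ [t _ <-].
    exists (@ll_inv _ _ _ _ _ _ _ _ (LevelLattice r2 l2 b2) (f1 t)) => //.
    have := E (f1 t); rewrite /stratum_fun /= => ->.
    by rewrite (ll_isoK (LevelLattice r1 l1 b1)).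
  exists (@ll_inv _ _ _ _ _ _ _ _ (LevelLattice r1 l1 b1) (f2 t)) => //.
  have := E (f2 t); rewrite /stratum_fun /= => <-.
  by rewrite (ll_isoK (LevelLattice r2 l2 b2)).
subst U2; congr existT; apply: level_lattice_ext => t.
have /selection_inj E' := E (f1 t).
rewrite -[LHS](@ll_invK _ _ _ _ _ _ _ _ (LevelLattice r2 l2 b2)) /= E'.
by rewrite (ll_isoK (LevelLattice r1 l1 b1)).
Qed.

Hypothesis (hF : global_function_field F) (hN : exists2 a, a \in N & a != 0).

(** An injective linear map carries a basis of T(L) to a basis of its image. *)
Lemma range_free (L : lattice inf aC iota) s
    (f : lattice_torsion N L -> std_torsion_pow N r) :
  has_rank L s -> linear f -> injective f -> free_submodule s (range f).
Proof.
move=> Ls lf injf; have [m Hm] := lattice_torsion_free hF hN Ls.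
pose fl := GRing.isLinear.Build _ _ _ _ f lf.
pose g : {linear lattice_torsion N L -> std_torsion_pow N r} := HB.pack f fl.
have gsum (a : 'I_s -> {ideal_quot N}) : f (\sum_i a i *: m i) = \sum_i a i *: f (m i).
  rewrite -[LHS]/(g _) linear_sum; apply: eq_bigr => i _; exact: (linearZ_LR g).
split; [split=> [|a _ _ [x _ <-] [y _ <-]]|].
- by exists 0 => //; exact: (raddf0 g).
- by exists (a *: x + y) => //; rewrite lf.
- exists (f \o m); split=> [i|_ [x _ <-]]; first by exists (m i).
  have [a [aE a_uniq]] := Hm x; exists a; split=> [|b].
    by rewrite {1}aE gsum.
  by rewrite -gsum => /injf /a_uniq.
Qed.

(** The preimage of (L, j) is (L, alpha) in the copy indexed by U = Im j, where
    alpha v is the unique m with j m = delta_U v. *)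
Lemma strata_map_surj (y : inj_lattice N aC iota r) :
  exists x : strata N aC iota r, strata_map delta x = y.
Proof.
case: y => L rk f lf injf; have [s sr Ls] := rk.
pose s' : 'I_r.+1 := Ordinal (sr : (s < r.+1)%N).
pose U : Free N s' r := exist _ (range f) (range_free Ls lf injf).
have /choice[al Hal] v : exists m, f m = selection delta U v.
  have : range (selection delta U) (selection delta U v) by exists v.
  by rewrite selection_image => -[m _ <-]; exists m.
have al_lin : linear al.
  by move=> a u v; apply: (injf); rewrite lf !Hal selection_linear.
have /choice[be Hbe] m : exists v, selection delta U v = f m.
  have : sval U (f m) by exists m.
  by rewrite -(selection_image delta) => -[v _ <-]; exists v.
have be_al : cancel al be.
  by move=> v; apply: (selection_inj (i := delta) (U := U)); rewrite Hbe Hal.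
have al_be : cancel be al by move=> m; apply: (injf); rewrite Hal Hbe.
pose X : level_lattice N aC iota s' := LevelLattice Ls al_lin (Bijective be_al al_be).
exists (existT _ (existT _ s' U) X); apply: inj_lattice_ext => m.
rewrite /= /stratum_fun /= -Hal; congr f.
exact: (ll_invK (m : lattice_torsion N (ll_lattice X))).
Qed.

End Bijection.

Theorem theorem49 (F : fieldType) (hF : global_function_field F)
    (inf : place F)
    (R : realType) (C : fieldType) (aC : absval R C)
    (iota : {rmorphism F -> C}) (hC : is_C_infty inf aC iota)
    (r : nat) (hr : (1 <= r)%N)
    (N : idealr (regular_ring inf)) (hN : exists2 a, a \in N & a != 0)
    (delta : injective_selection N r) :
  bijective (strata_map delta : strata N aC iota r -> inj_lattice N aC iota r).
Proof.
have /choice[inv invK] := @strata_map_surj F inf R C aC iota N r delta hF hN.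
by exists inv => // x; apply: (@strata_map_inj F inf R C aC iota N r delta); rewrite invK.
Qed.
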